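(* Fix integers $P,L\ge 1$, constants $\nu\ge 1$ and $\zeta, M_\delta, M_\epsilon, M_0\in(0,\infty)$, and a kernel $K$ on $\mathcal U$ whose eigenvalues satisfy $\tau_k\asymp k^{-2h}$ for some $h\ge 1$. For each $n$ let the covariates $X_{ip}$ ($1\le i\le n$, $1\le p\le P$) and the sampling numbers $m_i=m_i^{(n)}\ge 1$ be fixed and satisfy the covariate assumptions (6) and (7) of the context. Let $m=\big(\frac1n\sum_{i=1}^n m_i^{-1}\big)^{-1}$ be the harmonic mean and $m_a=\frac1n\sum_{i=1}^n m_i$ the arithmetic mean of the $m_i$, and assume that these are asymptotically equivalent in the sense that $m_a\asymp m$ as $n\to\infty$. Let $\mathcal M$ be the collection of all probability models for the data (with these $X_{ip}$ and $m_i$ held fixed) that satisfy assumptions (1)–(9) of the context and have $\|\beta_{\ell p}\|_{\mathbb K}\le M_0$ for all $\ell,p$. Then for any estimator $\hat\beta=(\hat\beta_{\ell p})$ (for each $n$, a function of the observed data, with values $\hat\beta_{\ell p}\in L^2(\mathcal U,\mu)$), the excess risk $R_n=\sum_{p=1}^P\sum_{\ell=1}^L\|\hat\beta_{\ell p}-\beta_{\ell p}\|^2$ satisfies $$\limsup_{n\to\infty}\ \inf_{M\in\mathcal M} P_M\Big(R_n\le \epsilon\big((nm)^{-2h/(2h+1)}+n^{-1}\big)\Big)\ \longrightarrow\ 0\qquad\text{as }\epsilon\to 0^+,$$ where $P_M$ denotes probability under the model $M$.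
   Context: Domain and kernel. $\mathcal U$ is a compact $d$-dimensional (topological, second countable, Hausdorff) manifold, $d<\infty$, equipped with a Borel probability measure $\mu$ whose support is $\mathcal U$. $L^2=L^2(\mathcal U,\mu)$; $\|\cdot\|$ and $\langle\cdot,\cdot\rangle$ without subscript are the norm and inner product of $L^2$. $K:\mathcal U\times\mathcal U\to\mathbb R^+$ is a symmetric, positive definite, continuous kernel with Mercer expansion $K(u,s)=\sum_{k\ge1}\tau_k v_k(u)v_k(s)$, where the $v_k$ are orthonormal in $L^2$ and $(\tau_k)$ is positive, non-increasing and summable. $\mathbb K$ is the reproducing kernel Hilbert space of $K$: it consists of the $f$ in the closed linear span of $\{v_k\}$ in $L^2$ (taken as their continuous representatives) with $\sum_k\langle f,v_k\rangle^2/\tau_k<\infty$, with inner product $\langle f,g\rangle_{\mathbb K}=\sum_k\tau_k^{-1}\langle f,v_k\rangle\langle g,v_k\rangle$. The notation $a_k\asymp b_k$ means that $a_k/b_k$ is eventually bounded above and bounded below away from $0$. Model assumptions. (1) The observed data are $\{Y_{ij\ell},u_{ij},X_{i1},\dots,X_{iP}\}$ for $i=1,\dots,n$, $j=1,\dots,m_i$, $\ell=1,\dots,L$. (2) The $u_{ij}$ are iid random elements of $\mathcal U$ having a density with respect to $\mu$ which is bounded above and bounded below away from $0$. (3) $Y_{ij\ell}=\sum_{p=1}^P X_{ip}\beta_{\ell p}(u_{ij})+\varepsilon_{i\ell}(u_{ij})+\delta_{ij\ell}$. (4) $\beta_{\ell p}\in\mathbb K$ for all $\ell,p$, and the eigenvalues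 of $K$ satisfy $\tau_k\asymp k^{-2h}$ with $h\ge1$. (5) The families $(\varepsilon_{i\ell})$ (stochastic processes with values in $L^2$), $(u_{ij})$ and $(\delta_{ij\ell})$ are random and independent of each other. (6) The covariates $X_{ip}$ are deterministic; writing $X_i=(X_{i1},\dots,X_{iP})^\top$ and $\Sigma_X=n^{-1}\sum_{i=1}^n X_iX_i^\top$, for all large $n$ one has $0<\nu^{-1}\le\sigma_{\min}(\Sigma_X)\le\sigma_{\max}(\Sigma_X)\le\nu<\infty$ (smallest and largest eigenvalues). (7) $|X_{ip}|\le\zeta<\infty$ for all $i,p$. (8) The $\delta_{ij\ell}$ are iid across $i$ and $j$, possibly dependent across $\ell$, with mean zero and $\operatorname{Var}(\delta_{ij\ell})\le M_\delta<\infty$. (9) The processes $\varepsilon_{i\ell}$ are iid across $i$, possibly dependent across $\ell$, with mean zero and $\sup_{u\in\mathcal U}\operatorname{Var}(\varepsilon_{i\ell}(u))\le M_\epsilon<\infty$. A model $M\in\mathcal M$ specifies the distributions of $(\varepsilon_{i\ell},\delta_{ij\ell},u_{ij})$ and the values of the $\beta_{\ell p}$. *)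

(* Defs.v *)
From HB Require Import structures.
From mathcomp Require Import all_boot all_order all_algebra.
From mathcomp Require Import all_classical all_reals all_analysis.

Set Implicit Arguments.
Unset Strict Implicit.
Unset Printing Implicit Defensive.

Import Order.TTheory GRing.Theory Num.Theory.
Import numFieldNormedType.Exports.

Local Open Scope classical_set_scope.
Local Open Scope ring_scope.

Definition asymp_equiv (R : realType) (a b : nat -> R) : Prop :=
  exists c C : R, 0 < c /\ \forall k \near \oo, c <= a k / b k <= C.

(* Second countable Hausdorff space, locally homeomorphic to open subsets of
   R^d (no boundary). *)
Definition topological_manifold (R : realType) (d : nat)
    (U : topologicalType) : Prop :=
  [/\ hausdorff_space U, @second_countable U &
    forall x : U, exists A : set U, [/\ open A, A x &
      exists (phi : U -> 'rV[R]_d) (psi : 'rV[R]_d -> U),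
        [/\ open (phi @` A), {within A, continuous phi},
            {within phi @` A, continuous psi} &
            forall y, A y -> psi (phi y) = y]]].

Definition borel (U : ptopologicalType) := g_sigma_algebraType (@open U).

Definition full_support (R : realType) (U : ptopologicalType)
    (mu : probability (borel U) R) : Prop :=
  forall A : set U, open A -> A !=set0 -> (0 < mu A)%E.

Section L2.
Context (R : realType) (U : ptopologicalType) (mu : probability (borel U) R).

Definition inL2 (f : U -> R) : Prop := (f : borel U -> R) \in Lfun mu 2%:E.

Definition normL2 (f : U -> R) : \bar R :=
  'N[mu]_2%:E [EFin \o (f : borel U -> R)]%E.

Definition innerL2 (f g : U -> R) : R :=
  Rintegral mu [set: borel U] (fun x : borel U => f x * g x).

Definition orthonormalL2 (v : nat -> U -> R) : Prop :=
  (forall k, inL2 (v k)) /\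
  (forall j k, innerL2 (v j) (v k) = (j == k)%:R).

End L2.

Section Kernel.
Context (R : realType) (U : ptopologicalType) (mu : probability (borel U) R).

(* The codomain of K is the set of nonnegative reals; "positive definite" is
   meant as for reproducing kernels, i.e. the Gram matrices are positive
   semidefinite. *)
Definition continuous_pd_kernel (K : U -> U -> R) : Prop :=
  [/\ forall x y, 0 <= K x y,
      forall x y, K x y = K y x,
      continuous (fun z : U * U => K z.1 z.2) &
      forall (N : nat) (x : 'I_N -> U) (c : 'I_N -> R),
        0 <= \sum_(i < N) \sum_(j < N) c i * c j * K (x i) (x j)].

(* Mercer expansion K(u,s) = sum_{k >= 1} tau_k v_k(u) v_k(s), the v_k being the
   continuous representatives.  Sequences are indexed from 0: tau k and v k
   stand for tau_{k+1} and v_{k+1}. *)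
Definition mercer_expansion (K : U -> U -> R) (tau : nat -> R)
    (v : nat -> U -> R) : Prop :=
  [/\ [/\ forall k, 0 < tau k, forall j k, (j <= k)%N -> tau k <= tau j
        & cvgn (series tau)],
      orthonormalL2 mu v,
      forall k, continuous (v k) &
      forall x y, series (fun k => tau k * v k x * v k y) @ \oo --> K x y].

Definition eigenvalue_decay (tau : nat -> R) (h : R) : Prop :=
  asymp_equiv tau (fun k => k.+1%:R `^ (- (2 * h))).

Definition in_closed_span (v : nat -> U -> R) (f : U -> R) : Prop :=
  inL2 mu f /\
  forall e : R, 0 < e -> exists (N : nat) (c : nat -> R),
    (normL2 mu (fun x => (f x - \sum_(k < N) c k * v k x)%R) < e%:E)%E.

Definition rkhs_terms (tau : nat -> R) (v : nat -> U -> R) (f : U -> R) :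
    nat -> R :=
  fun k => innerL2 mu f (v k) ^+ 2 / tau k.

Definition in_rkhs (tau : nat -> R) (v : nat -> U -> R) (f : U -> R) : Prop :=
  [/\ continuous f, in_closed_span v f & cvgn (series (rkhs_terms tau v f))].

Definition rkhs_norm (tau : nat -> R) (v : nat -> U -> R) (f : U -> R) : R :=
  Num.sqrt (limn (series (rkhs_terms tau v f))).

End Kernel.

Section Independence.
Context (d : measure_display) (Omega : measurableType d) (R : realType)
  (Pr : probability Omega R).

Definition family_sigma (T : Type) (d' : measure_display)
    (E : measurableType d') (Z : T -> Omega -> E) : set (set Omega) :=
  <<s \bigcup_t preimage_set_system [set: Omega] (Z t) measurable >>.

Definition mutually_independent (I : finType) (F : I -> set (set Omega)) :
    Prop :=
  forall (J : {set I}) (A : I -> set Omega),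
    (forall i, i \in J -> F i (A i)) ->
    Pr (\bigcap_(i in [set` J]) A i) = (\prod_(i in J) Pr (A i))%E.

(* Two families indexed by the same T (random vectors if T is finite,
   stochastic processes in general) have the same law, i.e. the same
   finite-dimensional distributions. *)
Definition same_law (T : Type) (d' : measure_display) (E : measurableType d')
    (Z Z' : T -> Omega -> E) : Prop :=
  forall (N : nat) (t : 'I_N -> T) (B : 'I_N -> set E),
    (forall k, measurable (B k)) ->
    Pr (\bigcap_k (Z (t k) @^-1` B k)) = Pr (\bigcap_k (Z' (t k) @^-1` B k)).

Definition iid_families (I : finType) (T : Type) (d' : measure_display)
    (E : measurableType d') (Z : I -> T -> Omega -> E) : Prop :=
  mutually_independent (fun i => family_sigma (Z i)) /\
  forall i i', same_law (Z i) (Z i').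

Definition centered_var_le (X : Omega -> R) (M : R) : Prop :=
  [/\ Pr.-integrable [set: Omega] (EFin \o X), ('E_Pr[X] = 0)%E &
      ('V_Pr[X] <= M%:E)%E].

End Independence.

(* Sigma_X = n^-1 sum_i X_i X_i^T, where X_i is the transpose of row i of X *)
Definition SigmaX (R : realType) (n p : nat) (X : 'M[R]_(n, p)) : 'M[R]_p :=
  n%:R^-1 *: \sum_(i < n) (row i X)^T *m row i X.

(* Smallest and largest eigenvalue; meaningful for the symmetric matrices to
   which they are applied, whose spectrum is real and nonempty when p > 0. *)
Definition sigma_min (R : realType) (p : nat) (S : 'M[R]_p) : R :=
  inf [set a | eigenvalue S a].

Definition sigma_max (R : realType) (p : nat) (S : 'M[R]_p) : R :=
  sup [set a | eigenvalue S a].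

Definition covariates_ok (R : realType) (p : nat)
    (X : forall n, 'M[R]_(n, p)) (nu zeta : R) : Prop :=
  (\forall n \near \oo,
     [/\ 0 < nu^-1, nu^-1 <= sigma_min (SigmaX (X n)),
         sigma_min (SigmaX (X n)) <= sigma_max (SigmaX (X n)) &
         sigma_max (SigmaX (X n)) <= nu]) /\
  (forall n i q, `|X n i q| <= zeta).

Definition harm_mean (R : realType) (n : nat) (m : 'I_n -> nat) : R :=
  (n%:R^-1 * \sum_(i < n) (m i)%:R^-1)^-1.

Definition arith_mean (R : realType) (n : nat) (m : 'I_n -> nat) : R :=
  n%:R^-1 * \sum_(i < n) (m i)%:R.

(* The pairs (i, j) with i < n and j < m_i. *)
Definition obs (n : nat) (m : 'I_n -> nat) : finType := {i : 'I_n & 'I_(m i)}.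

Section Data.
Context (R : realType) (U : ptopologicalType) (p L n : nat) (m : 'I_n -> nat).

Record data := Data {
  dataY : obs m -> 'I_L -> R ;
  dataU : obs m -> U ;
  dataX : 'M[R]_(n, p)
}.

Definition data_measurable : set (set data) :=
  <<s (\bigcup_(ol : obs m * 'I_L)
         preimage_set_system [set: data] (fun D => dataY D ol.1 ol.2)
           (@measurable _ R)) `|`
      (\bigcup_(o : obs m)
         preimage_set_system [set: data] (fun D => dataU D o)
           (@measurable _ (borel U))) `|`
      (\bigcup_(iq : 'I_n * 'I_p)
         preimage_set_system [set: data] (fun D => dataX D iq.1 iq.2)
           (@measurable _ R)) >>.

(* L^2(mu) is separable here (mu is a finite Borel measure on a second countable
   space), hence its Borel sigma-algebra is generated by the closed balls. *)
Record estimator (mu : probability (borel U) R) := Estimator {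
  estim :> data -> 'I_L -> 'I_p -> U -> R ;
  estim_L2 : forall D l q, inL2 mu (estim D l q) ;
  estim_measurable : forall l q (g : U -> R) (r : R), inL2 mu g ->
    data_measurable
      [set D | (normL2 mu (fun x => (estim D l q x - g x)%R) <= r%:E)%E]
}.

Definition excess_risk (mu : probability (borel U) R)
    (bhat beta : 'I_L -> 'I_p -> U -> R) : \bar R :=
  (\sum_(q < p) \sum_(l < L)
     (normL2 mu (fun x => (bhat l q x - beta l q x)%R)) ^+ 2)%E.

End Data.

Section Model.
Context (R : realType) (U : ptopologicalType) (mu : probability (borel U) R)
  (p L n : nat) (m : 'I_n -> nat) (X : 'M[R]_(n, p)).

Record model := Model {
  disp : measure_display ;
  Omega : measurableType disp ;
  Pr : probability Omega R ;
  eps : 'I_n -> 'I_L -> Omega -> U -> R ;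
  loc : obs m -> {RV Pr >-> borel U} ;
  delta : obs m -> 'I_L -> {RV Pr >-> R} ;
  beta : 'I_L -> 'I_p -> U -> R
}.
Arguments eps : clear implicits.
Arguments loc : clear implicits.
Arguments delta : clear implicits.
Arguments beta : clear implicits.

Definition response (M : model) (w : Omega M) (o : obs m) (l : 'I_L) : R :=
  \sum_(q < p) X (tag o) q * beta M l q (loc M o w)
  + eps M (tag o) l w (loc M o w) + delta M o l w.

Definition model_data (M : model) (w : Omega M) : data R U p L m :=
  Data (response w) (fun o => loc M o w) X.

(* the process (l, x) |-> eps_{il}(x), for fixed i *)
Definition eps_process (M : model) (i : 'I_n) : 'I_L * U -> Omega M -> R :=
  fun lx w => eps M i lx.1 w lx.2.

Definition loc_ok (M : model) : Prop :=
  mutually_independent (Pr M)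
    (fun o => family_sigma (fun _ : unit => loc M o : Omega M -> borel U)) /\
  exists (f : borel U -> R) (c C : R),
    [/\ 0 < c, measurable_fun setT f, forall x, c <= f x <= C &
        forall o (A : set (borel U)), measurable A ->
          Pr M (loc M o @^-1` A) = (\int[mu]_(x in A) (f x)%:E)%E].

Definition delta_ok (Mdelta : R) (M : model) : Prop :=
  iid_families (Pr M) (fun o l => delta M o l : Omega M -> R) /\
  forall o l, centered_var_le (Pr M) (delta M o l) Mdelta.

(* The second clause says that eps_{il} is a measurable process with respect to
   the sigma-algebra it generates, tensored with the Borel sets of U.  Joint
   measurability in the sigma-algebra of Omega alone would not do: on
   ([0,1], Lebesgue) with loc(w) = w, the process 1{x = w} generates only null
   and conull sets, hence is independent of loc, yet equals 1 at loc. *)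
Definition eps_ok (Meps : R) (M : model) : Prop :=
  [/\ forall i l w, inL2 mu (eps M i l w),
      forall i l, measurable_fun
        [set: g_sigma_algebraType (family_sigma (@eps_process M i)) * borel U]
        (fun z => eps M i l z.1 z.2 : R),
      forall i l x, measurable_fun [set: Omega M] (fun w => eps M i l w x),
      iid_families (Pr M) (@eps_process M) &
      forall i l x, centered_var_le (Pr M) (fun w => eps M i l w x) Meps].

Definition independent_families (M : model) : Prop :=
  forall A B C : set (Omega M),
    family_sigma (fun ilx : 'I_n * ('I_L * U) => @eps_process M ilx.1 ilx.2) A ->
    family_sigma (fun o => loc M o : Omega M -> borel U) B ->
    family_sigma (fun ol : obs m * 'I_L =>
                    delta M ol.1 ol.2 : Omega M -> R) C ->
    Pr M (A `&` B `&` C) = (Pr M A * Pr M B * Pr M C)%E.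

Definition beta_ok (tau : nat -> R) (v : nat -> U -> R) (M0 : R) (M : model) :
    Prop :=
  forall l q, in_rkhs mu tau v (beta M l q) /\
              rkhs_norm mu tau v (beta M l q) <= M0.

Definition admissible (tau : nat -> R) (v : nat -> U -> R)
    (Mdelta Meps M0 : R) (M : model) : Prop :=
  [/\ loc_ok M, delta_ok Mdelta M, eps_ok Meps M, independent_families M &
      beta_ok tau v M0 M].

Definition worst_success (tau : nat -> R) (v : nat -> U -> R)
    (Mdelta Meps M0 : R) (bhat : estimator p L m mu) (r : R) : \bar R :=
  ereal_inf [set y | exists M : model, admissible tau v Mdelta Meps M0 M /\
    y = Pr M [set w | (excess_risk mu (bhat (model_data w)) (beta M)
                       <= r%:E)%E]].

End Model.

(* Main.v *)
(* Let the data under the hypothesis beta_theta, theta in a finite set Theta, be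
   those under beta = 0 after a translation of the Gaussian noise, and let L be
   the likelihood ratio of this translation.  For every event S and every t > 0,
     P_theta(S) <= t P_0(S) + E_0[L^2] / (4 t).
   Apply this to the event that the estimator is close to beta_theta.  If at most
   kappa of these events can occur simultaneously and E_0[L^2] <= C, averaging
   over Theta bounds the success probability by t kappa / |Theta| + C / (4 t).
   - For the rate 1/n the noise is carried by eps_i = z_i v_0, and the hypotheses
     are beta_k = (k / G) a n^(-1/2) v_0 for k < G; then kappa = 1 and C does not
     depend on n or G, so that t = sqrt G and G large give the claim.
   - For the rate (n m)^(-2h/(2h+1)) the noise is carried by the delta_ij, and the
     hypotheses are the vertices a sum_{D <= k < 2D} theta_k v_k of a cube, with
     D of order (n m)^(1/(2h+1)) and a^2 of order D^(-(2h+1)); then kappa is the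
     size of a Hamming ball, exponentially smaller than 2^D, C grows with a
     small exponential rate in D, and t = (11/10)^D gives the claim. *)

From HB Require Import structures.
Require Import Defs.
From mathcomp Require Import all_boot all_order all_algebra.
From mathcomp Require Import all_classical all_reals all_analysis.
From mathcomp Require Import measurable_realfun.
From mathcomp Require Import ring lra.
Import Order.TTheory GRing.Theory Num.Theory.
Import numFieldNormedType.Exports.
Local Open Scope classical_set_scope.
Local Open Scope ring_scope.

(** * Gaussian shifts *)

Import HBNNSimple.

(** The locations are random and belong to the data, so the likelihood ratio is averaged over them:
    its second moment is a product of integrals of exp(g(u)^2 / s^2), g being the translation and s
    the scale of the noise. These exponential moments reduce to the squared L2 norm of g because an
    RKHS ball is uniformly bounded, K being bounded on the diagonal. The two rates need two carriers
    of noise. A perturbation of eps_i is common to all observations of curve i, so the information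
    is that of n curves however densely they are sampled; but with eps_i = z_i v_0 it hides only the
    direction v_0. The delta_ij hide every direction, but their information grows with the number of
    observations, which is n times the arithmetic mean of the m_i; hence its comparison with the
    harmonic mean. The order of D balances smoothness and information: a^2 D / tau_(2D) must stay
    bounded, while a^2 D times the number of observations must be at most a small multiple of D.
    Dependence across l is allowed, so all L responses are taken equal and carry the information of
    one. The unknown function sits in the column q0 of beta, the other columns being zero. *)

Lemma ge0_integral_density d (T : measurableType d) (R : realType)
    (lam nu : {measure set T -> \bar R}) (p : T -> R) (f : T -> \bar R) :
  measurable_fun setT p -> (forall x, 0 <= p x) ->
  (forall A, measurable A -> nu A = \int[lam]_(x in A) (p x)%:E)%E ->
  measurable_fun setT f -> (forall x, 0 <= f x)%E ->
  (\int[nu]_x f x = \int[lam]_x (f x * (p x)%:E))%E.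
Proof.
move=> mp p0 nuE mf f0.
have indE A : measurable A ->
    (\int[nu]_x (\1_A x)%:E = \int[lam]_x ((\1_A x)%:E * (p x)%:E))%E.
  move=> mA; rewrite integral_indic// setIT nuE// [LHS]integral_mkcond/=.
  apply: eq_integral => x _; rewrite patchE indicE.
  by case: ifPn => xA; rewrite ?mul1e ?mul0e.
pose f_ := nnsfun_approx measurableT mf.
have nnE (g : {nnsfun T >-> R}) :
    (\int[nu]_x (g x)%:E = \int[lam]_x ((g x)%:E * (p x)%:E))%E.
  under [LHS]eq_integral do rewrite fimfunE -fsumEFin//.
  rewrite ge0_integral_fsum//; last 2 first.
  - by move=> r; exact/measurable_EFinP/measurableT_comp.
  - by move=> n x _; rewrite EFinM nnfun_muleindic_ge0.
  under [RHS]eq_integral.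
    move=> x _; rewrite fimfunE -fsumEFin// muleC ge0_mule_fsumr; last first.
      by move=> r; rewrite EFinM nnfun_muleindic_ge0.
    over.
  rewrite ge0_integral_fsum//; last 2 first.
  - move=> r; apply/measurable_EFinP/measurable_funM => //.
    exact: measurable_funM.
  - move=> r x _; apply: mule_ge0; first by rewrite lee_fin.
    by rewrite EFinM nnfun_muleindic_ge0.
  apply: eq_fsbigr => r rg.
  have r0 : 0 <= r by move: rg; rewrite inE => -[x _ <-].
  under eq_integral do rewrite EFinM.
  rewrite ge0_integralZl//; last exact/measurable_EFinP.
  rewrite indE//.
  under [RHS]eq_integral do rewrite muleC EFinM -muleA.
  rewrite ge0_integralZl//.
    by apply: emeasurable_funM; apply/measurable_EFinP.
  by move=> x _; rewrite mule_ge0 ?lee_fin.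
transitivity (limn (fun n => \int[nu]_x (f_ n x)%:E))%E.
  rewrite -monotone_convergence//=.
  - apply: eq_integral => ? _; apply/esym/cvg_lim => //=.
    by apply: cvg_nnsfun_approx.
  - by move=> n; exact/measurable_EFinP/measurable_funTS.
  - by move=> n ? _; rewrite lee_fin.
  - by move=> ? _ ? ? mn; rewrite lee_fin; exact/lefP/nd_nnsfun_approx.
rewrite (_ : (fun n => _) =
    fun n => \int[lam]_x ((f_ n x)%:E * (p x)%:E))%E; last first.
  by apply/funext => n; exact: nnE.
rewrite -monotone_convergence//=.
- apply: eq_integral => x _; apply/cvg_lim => //=.
  apply: cvgeZr; first by [].
  by apply: cvg_nnsfun_approx.
- by move=> n; apply: emeasurable_funM; apply/measurable_EFinP.
- by move=> n x _; rewrite mule_ge0 ?lee_fin.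
- move=> x _ a b ab; rewrite lee_pmul ?lee_fin//.
  exact/lefP/nd_nnsfun_approx.
Qed.

Section gaussian_noise.
Context {R : realType}.
Local Notation lam := (@lebesgue_measure R).

Let id_measurableTypeR : measurableTypeR R -> R := idfun.

HB.instance Definition _ :=
  @isMeasurableFun.Build _ _ _ _ id_measurableTypeR (@measurable_id _ _ setT).

(* [normal_prob] lives on [measurableTypeR R]; this is its copy on [R]. *)
Definition gauss (s : R) : probability R R :=
  distribution (normal_prob 0 s) id_measurableTypeR.

(** Reflections serve twice: two of them compose to a translation, and the one at 0 gives the
    symmetry of the centred Gaussian. They preserve the length of intervals, and uniqueness of
    Lebesgue measure does the rest. *)
Lemma lebesgue_measure_reflection (a : R) (A : set R) : measurable A ->
  pushforward lam (fun x : measurableTypeR R => a - x : measurableTypeR R) A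
  = lam A.
Proof.
have mr : measurable_fun setT (fun x : measurableTypeR R => a - x : measurableTypeR R).
  by apply: measurable_funB.
pose r : {mfun measurableTypeR R >-> measurableTypeR R} :=
  HB.pack (fun x : measurableTypeR R => a - x : measurableTypeR R)
    (isMeasurableFun.Build _ _ _ _ _ mr).
move=> mA; apply/esym.
apply: (lebesgue_measure_unique (mu := pushforward lam r)) => //= _ [[b c]] _ <-.
rewrite /pushforward/=.
rewrite (_ : (fun x => a - x) @^-1` _ = `[a - c, a - b[%classic); last first.
  by apply/seteqP; split=> x /=; rewrite !in_itv/= => /andP[? ?]; apply/andP; lra.
rewrite !lebesgue_measure_itv/= !lte_fin ltrD2l ltrN2.
by case: ifPn => // _; rewrite -EFinB; congr (_%:E); lra.
Qed.

Lemma ge0_integral_reflection (a : R) (f : R -> \bar R) :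
  measurable_fun setT f -> (forall x, 0 <= f x)%E ->
  (\int[lam]_x f (a - x)%R = \int[lam]_x f x)%E.
Proof.
move=> mf f0.
have mr : measurable_fun setT (fun x : measurableTypeR R => a - x : measurableTypeR R).
  by apply: measurable_funB.
rewrite -[LHS](ge0_integral_pushforward mr lam measurableT mf)//.
by apply: eq_measure_integral => A mA _; exact: lebesgue_measure_reflection.
Qed.

Lemma ge0_integral_translation (a : R) (f : R -> \bar R) :
  measurable_fun setT f -> (forall x, 0 <= f x)%E ->
  (\int[lam]_x f (x + a)%R = \int[lam]_x f x)%E.
Proof.
move=> mf f0.
rewrite -[RHS](ge0_integral_reflection a)// -[RHS](ge0_integral_reflection 0).
- by apply: eq_integral => x _; congr f; lra.
- by apply: measurableT_comp => //; apply: measurable_funB.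
- by [].
Qed.

Lemma ge0_integral_gauss (s : R) (f : R -> \bar R) :
  measurable_fun setT f -> (forall x, 0 <= f x)%E ->
  (\int[gauss s]_x f x = \int[lam]_x (f x * (normal_pdf 0 s x)%:E))%E.
Proof.
move=> mf f0; rewrite /gauss.
rewrite (ge0_integral_distribution (id_measurableTypeR : {RV (normal_prob 0 s) >-> _}))//.
apply: ge0_integral_density => //.
- exact: measurable_normal_pdf.
- by move=> x; exact: normal_pdf_ge0.
Qed.

Lemma ge0_integral_gaussN (s : R) (f : R -> \bar R) : s != 0 ->
  measurable_fun setT f -> (forall x, 0 <= f x)%E ->
  (\int[gauss s]_x f (- x)%R = \int[gauss s]_x f x)%E.
Proof.
move=> s0 mf f0; have mn : measurable_fun setT (f \o (fun x : R => - x)).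
  by apply: measurableT_comp => //; exact: oppr_measurable.
rewrite (ge0_integral_gauss s (f \o (fun x : R => - x)%R))//; last by move=> x; exact: f0.
rewrite ge0_integral_gauss//.
rewrite -[RHS](ge0_integral_reflection 0).
- apply: eq_integral => x _; rewrite /= sub0r; congr (_ * _%:E)%E.
  by rewrite !normal_pdfE// /normal_fun !subr0 sqrrN.
- apply: emeasurable_funM => //; apply/measurable_EFinP.
  exact: measurable_normal_pdf.
- by move=> x; rewrite mule_ge0// lee_fin normal_pdf_ge0.
Qed.

(* The density of N(a, s^2) with respect to N(0, s^2). *)
Definition gauss_ratio (s a x : R) : R := expR ((a * x - a ^+ 2 / 2) / s ^+ 2).

Lemma measurable_gauss_ratio (s : R) d (T : measurableType d) (a x : T -> R) :
  measurable_fun setT a -> measurable_fun setT x ->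
  measurable_fun setT (fun t => gauss_ratio s (a t) (x t)).
Proof.
move=> ma mx; apply: measurableT_comp => //.
apply: measurable_funM => //; apply: measurable_funB.
  exact: measurable_funM.
by apply: measurable_funM => //; exact: measurable_funX.
Qed.

Lemma ge0_integral_gauss_shift (s a : R) (f : R -> \bar R) : s != 0 ->
  measurable_fun setT f -> (forall x, 0 <= f x)%E ->
  (\int[gauss s]_x f (x + a)%R
   = \int[gauss s]_x (f x * (gauss_ratio s a x)%:E))%E.
Proof.
move=> s0 mf f0.
have mr : measurable_fun setT (fun x => (gauss_ratio s a x)%:E).
  by apply/measurable_EFinP; apply: measurable_gauss_ratio.
have r0 x : (0 <= (gauss_ratio s a x)%:E)%E by rewrite lee_fin expR_ge0.
have mt : measurable_fun setT (f \o (fun x : R => x + a)).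
  by apply: measurableT_comp => //; apply: measurable_funD.
rewrite (ge0_integral_gauss s (f \o (fun x : R => x + a)%R))//; last by move=> x; exact: f0.
rewrite [RHS]ge0_integral_gauss//; last 2 first.
- by apply: emeasurable_funM.
- by move=> x; rewrite mule_ge0.
rewrite -[RHS](ge0_integral_translation a).
- apply: eq_integral => x _; rewrite /= -muleA; congr (_ * _)%E.
  rewrite -EFinM; congr (_%:E); rewrite !normal_pdfE// mulrCA; congr (_ * _).
  rewrite /gauss_ratio /normal_fun -expRD; congr expR.
  rewrite -mulr_natr; field; exact: s0.
- apply: emeasurable_funM; first by apply: emeasurable_funM.
  by apply/measurable_EFinP; exact: measurable_normal_pdf.
- by move=> x; rewrite !mule_ge0// lee_fin normal_pdf_ge0.
Qed.

Lemma integral_gauss_ratio (s a : R) : s != 0 ->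
  (\int[gauss s]_x (gauss_ratio s a x)%:E = 1)%E.
Proof.
move=> s0; rewrite -[RHS](probability_setT (gauss s)).
rewrite -[RHS]mul1e -integral_cst//.
have /= -> // := ge0_integral_gauss_shift s a (cst 1%E).
by apply: eq_integral => x _; rewrite mul1e.
Qed.

(** The square of the ratio for the shift a is exp(a^2 / s^2) times the ratio for the shift 2a,
    which has integral 1. *)
Lemma integral_gauss_ratio_sqr (s a : R) : s != 0 ->
  (\int[gauss s]_x (gauss_ratio s a x ^+ 2)%:E = (expR (a ^+ 2 / s ^+ 2))%:E)%E.
Proof.
move=> s0.
rewrite -[RHS]mule1 -(integral_gauss_ratio s (2 * a) s0) -ge0_integralZl//.
- apply: eq_integral => x _; rewrite -EFinM /gauss_ratio -expRD expr2 -expRD.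
  by congr (expR _)%:E; field.
- by apply/measurable_EFinP; apply: measurable_gauss_ratio.
- by move=> x _; rewrite lee_fin expR_ge0.
Qed.

Lemma sqr_le_expR (x : R) : x ^+ 2 <= 4 * (expR x + expR (- x)).
Proof.
have key (y : R) : 0 <= y -> y ^+ 2 <= 4 * expR y.
  move=> y0; have e2 : expR y = expR (y / 2) ^+ 2.
    by rewrite expr2 -expRD; congr expR; field.
  have := expR_ge1Dx (y / 2); rewrite e2 => h.
  by nra.
have [x0|x0] := leP 0 x.
  by have := key x x0; have := expR_ge0 (- x); lra.
have := key (- x); rewrite oppr_ge0 => /(_ (ltW x0)).
by rewrite sqrrN; have := expR_ge0 x; lra.
Qed.

(** Up to the factor exp(1/2), the functions exp(x/s) and exp(-x/s) are the ratios for the shifts s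
    and -s, so the normalisation of [gauss_ratio] suffices. The constant is far from the true value
    1, but s is free and absorbs it. *)
Lemma gauss_second_moment (s : R) : s != 0 ->
  (\int[gauss s]_x (x ^+ 2)%:E <= (8 * expR (2^-1) * s ^+ 2)%:E)%E.
Proof.
move=> s0.
have m a : measurable_fun setT (fun x : R => (gauss_ratio s a x)%:E).
  by apply/measurable_EFinP; apply: measurable_gauss_ratio.
have p a x : (0 <= (gauss_ratio s a x)%:E)%E by rewrite lee_fin expR_ge0.
have c0 : 0 <= 4 * expR (2^-1) * s ^+ 2.
  by rewrite mulr_ge0 ?sqr_ge0// mulr_ge0 ?expR_ge0.
apply: (@le_trans _ _ (\int[gauss s]_x ((4 * expR (2^-1) * s ^+ 2)%:E *
    ((gauss_ratio s s x)%:E + (gauss_ratio s (- s) x)%:E)))%E).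
  apply: ge0_le_integral => //.
  - by move=> x _; rewrite lee_fin sqr_ge0.
  - by apply/measurable_EFinP; exact: measurable_funX.
  - by apply: emeasurable_funM => //; apply: emeasurable_funD; exact: m.
  move=> x _; rewrite -EFinD -EFinM lee_fin.
  have e1 : expR (2^-1) * gauss_ratio s s x = expR (x / s).
    by rewrite /gauss_ratio -expRD; congr expR; field.
  have e2 : expR (2^-1) * gauss_ratio s (- s) x = expR (- (x / s)).
    by rewrite /gauss_ratio -expRD; congr expR; field.
  have := sqr_le_expR (x / s).
  have s2 : 0 < s ^+ 2 by rewrite exprn_even_gt0.
  rewrite exprMn exprVn ler_pdivrMr// -e1 -e2 => h.
  by apply: le_trans h _; rewrite le_eqVlt; apply/orP; left; apply/eqP; ring.
rewrite ge0_integralZl//; last 2 first.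
- by apply: emeasurable_funD; exact: m.
- by move=> x _; rewrite adde_ge0.
rewrite ge0_integralD//.
rewrite !integral_gauss_ratio ?oppr_eq0//.
rewrite -EFinD -EFinM lee_fin; lra.
Qed.

Lemma gauss_integrable (s : R) : s != 0 ->
  (gauss s).-integrable setT (fun x => x%:E).
Proof.
move=> s0; apply/integrableP; split; first exact/measurable_EFinP.
apply: (@le_lt_trans _ _ (\int[gauss s]_x (1 + (x ^+ 2)%:E))%E).
  apply: ge0_le_integral => //.
  - by apply: measurableT_comp => //; exact/measurable_EFinP.
  - apply: emeasurable_funD => //.
    by apply/measurable_EFinP; exact: measurable_funX.
  move=> x _; rewrite abse_EFin -EFinD lee_fin.
  have := sqr_ge0 (`|x| - 1); have := sqr_ge0 `|x|; rewrite sqrrB1 real_normK ?num_real// -mulr_natr; lra.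
rewrite ge0_integralD//; last 2 first.
- by move=> x _; rewrite lee_fin sqr_ge0.
- by apply/measurable_EFinP; exact: measurable_funX.
rewrite integral_cst// mul1e lte_add_pinfty//.
  exact: le_lt_trans (probability_le1 (gauss s) measurableT) (ltry _).
exact: le_lt_trans (gauss_second_moment s s0) (ltry _).
Qed.

Lemma gauss_mean (s : R) : s != 0 -> (\int[gauss s]_x x%:E = 0)%E.
Proof.
move=> s0; have m : measurable_fun [set: R] (fun x : R => x%:E).
  exact/measurable_EFinP.
pose f := fun x : R => x%:E.
(* By symmetry the positive and negative parts have the same integral, which is finite. *)
have fN : (fun x : R => f^\-%E (- x)) = f^\+%E.
  by apply/funext => x; rewrite funeposE funenegE /f -EFinN opprK.
rewrite integralE -(ge0_integral_gaussN s f^\-%E)//; last exact: measurable_funeneg.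
rewrite fN subee//; apply: integrable_fin_num => //.
by apply: integrable_funepos => //; exact: gauss_integrable.
Qed.

End gaussian_noise.

(** * Product probabilities on tuples *)

Section tuple_product.
Context d (T : measurableType d) (R : realType).
Implicit Type P : probability T R.

Definition tcons n (x : T * n.-tuple T) : n.+1.-tuple T :=
  [tuple of x.1 :: x.2].

Lemma measurable_tcons n : measurable_fun setT (@tcons n).
Proof. exact: measurable_cons. Qed.

HB.instance Definition _ n :=
  isMeasurableFun.Build _ _ _ _ (@tcons n) (measurable_tcons n).

(** The n-fold product of P. The recursion on the first coordinate makes Tonelli's theorem available
    by induction on n. *)
Fixpoint tprob P n : probability (n.-tuple T) R :=
  match n with
  | 0 => dirac [tuple]
  | k.+1 => distribution (P \x tprob P k)%E (@tcons k)
  end.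

Lemma ge0_integral_tprobS P n (f : n.+1.-tuple T -> \bar R) :
  measurable_fun setT f -> (forall t, 0 <= f t)%E ->
  (\int[tprob P n.+1]_t f t
   = \int[P]_x \int[tprob P n]_t f [tuple of x :: t])%E.
Proof.
move=> mf f0 /=.
rewrite (ge0_integral_distribution (@tcons n : {RV (P \x tprob P n)%E >-> _}))//.
rewrite fubini_tonelli1//.
- by apply: measurableT_comp => //; exact: measurable_tcons.
- by move=> z; exact: f0.
Qed.

Lemma integral_tprob_prod P n (g : 'I_n -> T -> R) :
  (forall i, measurable_fun setT (g i)) -> (forall i x, 0 <= g i x) ->
  (\int[tprob P n]_t (\prod_(i < n) g i (tnth t i))%:E
   = \prod_(i < n) \int[P]_x (g i x)%:E)%E.
Proof.
elim: n g => [|n IH] g mg g0.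
  rewrite big_ord0; under eq_integral do rewrite big_ord0.
  by rewrite integral_cst//= diracT mule1.
have mp k (h : 'I_k -> T -> R) : (forall i, measurable_fun setT (h i)) ->
    measurable_fun setT (fun t : k.-tuple T => (\prod_(i < k) h i (tnth t i))%:E).
  move=> mh; apply/measurable_EFinP/measurable_prod => i _.
  by apply: measurableT_comp => //; exact: measurable_tnth.
rewrite ge0_integral_tprobS; [|exact: mp|]; last first.
  by move=> t; rewrite lee_fin prodr_ge0.
under eq_integral => x _.
  under eq_integral => t _.
    rewrite big_ord_recl tnth0 EFinM.
    under eq_bigr do rewrite tnthS.
    over.
  rewrite ge0_integralZl//; last 3 first.
  - by apply: (mp n (fun i => g (lift ord0 i))) => i; exact: mg.
  - by move=> t _; rewrite lee_fin prodr_ge0.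
  - by rewrite lee_fin.
  rewrite (IH (fun i => g (lift ord0 i)))//.
  over.
rewrite ge0_integralZr//.
- by rewrite big_ord_recl.
- exact/measurable_EFinP.
- by move=> x _; rewrite lee_fin.
- by apply: prode_ge0 => i _; apply: integral_ge0 => x _; rewrite lee_fin.
Qed.

Lemma tprob_bigcap P n (B : 'I_n -> set T) : (forall i, measurable (B i)) ->
  tprob P n (\bigcap_i [set t | B i (tnth t i)]) = (\prod_(i < n) P (B i))%E.
Proof.
move=> mB.
have mS : measurable (\bigcap_i [set t : n.-tuple T | B i (tnth t i)]).
  apply: fin_bigcap_measurable => // i _.
  by have := measurable_tnth i measurableT (mB i); rewrite setTI.
rewrite -[LHS]mul1e -[LHS](integral_cst (tprob P n))//.
rewrite integral_mkcond/=.
transitivity (\int[tprob P n]_t (\prod_(i < n) \1_(B i) (tnth t i))%:E)%E.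
  apply: eq_integral => t _; rewrite patchE; case: ifPn => [|].
    by rewrite inE => tB; rewrite big1// => i _; rewrite indicE mem_set//; exact: tB.
  move=> /negP tB; have [i tBi] : exists i, ~ B i (tnth t i).
    apply/existsNP => h; apply: tB; rewrite inE => i _; exact: h.
  by rewrite (bigD1 i)//= indicE memNset// mul0r.
rewrite (integral_tprob_prod P n (fun i => \1_(B i)))//.
by apply: eq_bigr => i _; rewrite integral_indic// setIT.
Qed.

(** Here [l i] is the density, with respect to P, of the law of [phi i] under P; densities multiply
    over independent coordinates. In the induction the integral over the tail, as a function of the
    head, is the test function for [phi ord0]. *)
Lemma ge0_integral_tprob_shift P n (phi : 'I_n -> T -> T) (l : 'I_n -> T -> R)
    (f : n.-tuple T -> \bar R) :
  (forall i, measurable_fun setT (phi i)) ->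
  (forall i, measurable_fun setT (l i)) -> (forall i x, 0 <= l i x) ->
  (forall i (g : T -> \bar R), measurable_fun setT g -> (forall x, 0 <= g x)%E ->
    \int[P]_x g (phi i x) = \int[P]_x (g x * (l i x)%:E))%E ->
  measurable_fun setT f -> (forall t, 0 <= f t)%E ->
  (\int[tprob P n]_t f [tuple phi i (tnth t i) | i < n]
   = \int[tprob P n]_t (f t * (\prod_(i < n) l i (tnth t i))%:E))%E.
Proof.
elim: n phi l f => [|n IH] phi l f mphi ml l0 philP mf f0.
  apply: eq_integral => t _; rewrite big_ord0 mule1; congr f.
  by rewrite (tuple0 t); apply: tuple0.
have mp k (h : 'I_k -> T -> R) : (forall i, measurable_fun setT (h i)) ->
    measurable_fun setT (fun t : k.-tuple T => (\prod_(i < k) h i (tnth t i))%:E).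
  move=> mh; apply/measurable_EFinP/measurable_prod => i _.
  by apply: measurableT_comp => //; exact: measurable_tnth.
have mc x : measurable_fun setT (fun t : n.-tuple T => f [tuple of x :: t]).
  by apply: measurableT_comp => //; exact: measurable_cons.
have m2 : measurable_fun setT (fun z : T * n.-tuple T => f (tcons n z)).
  by apply: measurableT_comp => //; exact: measurable_tcons.
rewrite ge0_integral_tprobS; last 2 first.
- apply: (measurableT_comp mf); apply/measurable_fun_tnthP => i /=.
  rewrite (_ : _ \o _ = fun t => phi i (tnth t i)); last first.
    by apply/funext => t /=; rewrite tnth_mktuple.
  by apply: measurableT_comp => //; exact: measurable_tnth.
- by move=> t; exact: f0.
rewrite ge0_integral_tprobS; last 2 first.
- by apply: emeasurable_funM => //; exact: mp.
- by move=> t; rewrite mule_ge0// lee_fin prodr_ge0.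
pose F x := (\int[tprob P n]_t
  (f [tuple of x :: t] * (\prod_(i < n) l (lift ord0 i) (tnth t i))%:E))%E.
have mpl : measurable_fun setT (fun t : n.-tuple T =>
    (\prod_(i < n) l (lift ord0 i) (tnth t i))%:E).
  by apply: (mp n (fun i => l (lift ord0 i))).
have pl0 (t : n.-tuple T) : (0 <= (\prod_(i < n) l (lift ord0 i) (tnth t i))%:E)%E.
  by rewrite lee_fin prodr_ge0.
transitivity (\int[P]_x F (phi ord0 x))%E.
  apply: eq_integral => x _; rewrite /F.
  rewrite -(IH (fun i => phi (lift ord0 i)) (fun i => l (lift ord0 i)) (fun t => f [tuple of phi ord0 x :: t]))//.
  - apply: eq_integral => t _; congr f; apply/eq_from_tnth => i.
    case: (unliftP ord0 i) => [j|] ->; rewrite tnth_mktuple ?tnth0 ?tnthS//.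
    by rewrite tnth_mktuple.
  - by move=> i g mg g0; exact: philP.
rewrite philP.
- apply: eq_integral => x _; rewrite /F muleC -ge0_integralZl//.
  + apply: eq_integral => t _; rewrite big_ord_recl tnth0.
    under [in RHS]eq_bigr do rewrite tnthS.
    by rewrite muleCA -EFinM.
  + by apply: emeasurable_funM.
  + by move=> t _; rewrite mule_ge0.
  + by rewrite lee_fin.
- apply: (measurable_fun_fubini_tonelli_F
    (fun z : T * n.-tuple T => f (tcons n z)
       * (\prod_(i < n) l (lift ord0 i) (tnth z.2 i))%:E)%E).
  + apply: emeasurable_funM => //.
    exact: (measurableT_comp mpl).
  + by move=> z; apply: mule_ge0.
- by move=> x; apply: integral_ge0 => t _; apply: mule_ge0.
Qed.

End tuple_product.

Arguments tcons {d T} n x.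
Arguments tprob {d T R} P n.
Arguments integral_tprob_prod {d T R} P {n} g.
Arguments ge0_integral_tprob_shift {d T R} P {n} phi l f.

(** * Gaussian shifts of a random design *)

Section gaussian_shift.
Context d (V : measurableType d) (R : realType) (mu : probability V R).
Variables (s : R) (N : nat).

Definition design_noise : probability (N.-tuple V * N.-tuple R)%type R :=
  (tprob mu N \x tprob (gauss s) N)%E.

Definition shift (g : 'I_N -> V -> R) (w : N.-tuple V * N.-tuple R) :
    N.-tuple V * N.-tuple R :=
  (w.1, [tuple tnth w.2 i + g i (tnth w.1 i) | i < N]).

Lemma measurable_shift (g : 'I_N -> V -> R) :
  (forall i, measurable_fun setT (g i)) -> measurable_fun setT (shift g).
Proof.
move=> mg; apply: measurable_fun_pair => //.
apply/measurable_fun_tnthP => i /=.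
rewrite (_ : _ \o _ = fun w => tnth w.2 i + g i (tnth w.1 i)); last first.
  by apply/funext => w /=; rewrite tnth_mktuple.
apply: measurable_funD.
  exact: (measurableT_comp (measurable_tnth i) measurable_snd).
apply: (measurableT_comp (mg i)).
exact: (measurableT_comp (measurable_tnth i) measurable_fst).
Qed.

(* With L the likelihood ratio of the shifted law, the indicator b of S satisfies
   b L <= t b + L^2 / (4 t). *)
Lemma design_noise_shift_le (g : 'I_N -> V -> R) S (t : R) :
  s != 0 -> (forall i, measurable_fun setT (g i)) -> measurable S -> 0 < t ->
  (design_noise (shift g @^-1` S) <= t%:E * design_noise S
     + ((4 * t)^-1)%:E * \prod_(i < N) \int[mu]_x (expR (g i x ^+ 2 / s ^+ 2))%:E)%E.
Proof.
move=> s0 mg mS t0.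
have mS' : measurable (shift g @^-1` S).
  by rewrite -[X in measurable X]setTI; exact: measurable_shift.
have mI (A : set (N.-tuple V * N.-tuple R)) : measurable A ->
    measurable_fun setT (fun w => (\1_A w)%:E : \bar R).
  by move=> mA; apply/measurable_EFinP.
have indE (A : set (N.-tuple V * N.-tuple R)) : measurable A -> design_noise A =
    (\int[tprob mu N]_u \int[tprob (gauss s) N]_z (\1_A (u, z))%:E)%E.
  move=> mA; rewrite -(setIT A) -integral_indic// setIT.
  apply: (fubini_tonelli1 (fun z => (\1_A z)%:E)); first exact: mI.
  by move=> w; rewrite lee_fin.
pose L (w : N.-tuple V * N.-tuple R) :=
  \prod_(i < N) gauss_ratio s (g i (tnth w.1 i)) (tnth w.2 i).
have mgt i : measurable_fun setT
    (fun w : N.-tuple V * N.-tuple R => g i (tnth w.1 i)).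
  apply: (measurableT_comp (mg i)).
  exact: (measurableT_comp (measurable_tnth i) measurable_fst).
have mL : measurable_fun setT L.
  apply: measurable_prod => i _.
  apply: measurable_gauss_ratio; first exact: mgt.
  exact: (measurableT_comp (measurable_tnth i) measurable_snd).
have m2 (f : N.-tuple V * N.-tuple R -> \bar R) u : measurable_fun setT f ->
    measurable_fun setT (fun z => f (u, z)).
  by move=> mf; exact: (measurableT_comp mf (pair1_measurable u)).
have mF (f : N.-tuple V * N.-tuple R -> \bar R) : measurable_fun setT f ->
    (forall w, 0 <= f w)%E ->
    measurable_fun setT (fun u => \int[tprob (gauss s) N]_z f (u, z))%E.
  by move=> mf f0; exact: (measurable_fun_fubini_tonelli_F f).
have L20 w : (0 <= (L w ^+ 2)%:E)%E by rewrite lee_fin sqr_ge0.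
have mL2 : measurable_fun setT (fun w => (L w ^+ 2)%:E).
  by apply/measurable_EFinP; exact: measurable_funX.
have mLI : measurable_fun setT (fun w => (\1_S w)%:E * (L w)%:E)%E.
  by apply: emeasurable_funM; [exact: mI|exact/measurable_EFinP].
have L0 w : 0 <= L w by apply: prodr_ge0 => i _; exact: expR_ge0.
have c0 : 0 <= (4 * t)^-1 by rewrite invr_ge0; lra.
have mtI : measurable_fun setT (fun w => t%:E * (\1_S w)%:E)%E.
  by apply: emeasurable_funM => //; exact: mI.
have mcL : measurable_fun setT (fun w => ((4 * t)^-1)%:E * (L w ^+ 2)%:E)%E.
  by apply: emeasurable_funM.
have tI0 w : (0 <= t%:E * (\1_S w)%:E :> \bar R)%E.
  by rewrite mule_ge0// lee_fin// ltW.
have cL0 w : (0 <= ((4 * t)^-1)%:E * (L w ^+ 2)%:E)%E.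
  by rewrite mule_ge0// lee_fin.
rewrite indE//.
(* Once the locations u are fixed, the translation is by the constants [g i (tnth u i)], and the
   likelihood ratio is a product over coordinates. *)
rewrite [leLHS](_ : _ = \int[tprob mu N]_u \int[tprob (gauss s) N]_z
    ((\1_S (u, z))%:E * (L (u, z))%:E))%E; last first.
  apply: eq_integral => u _.
  rewrite -(ge0_integral_tprob_shift (gauss s)
    (fun i x => x + g i (tnth u i)) (fun i => gauss_ratio s (g i (tnth u i)))
    (fun z => (\1_S (u, z))%:E))//.
  - by move=> i; apply: measurable_funD.
  - by move=> i; apply: measurable_gauss_ratio.
  - by move=> i x; exact: expR_ge0.
  - by move=> i f mf f0; exact: ge0_integral_gauss_shift.
  - by apply: (m2 (fun w => (\1_S w)%:E)); exact: mI.
apply: (@le_trans _ _ (\int[tprob mu N]_u \int[tprob (gauss s) N]_z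
    (t%:E * (\1_S (u, z))%:E + ((4 * t)^-1)%:E * (L (u, z) ^+ 2)%:E)))%E.
  apply: ge0_le_integral => //.
  - by move=> u _; apply: integral_ge0 => z _; rewrite mule_ge0// lee_fin.
  - by apply: (mF (fun w => (\1_S w)%:E * (L w)%:E)%E) => // w; rewrite mule_ge0// lee_fin.
  - apply: (mF (fun w => t%:E * (\1_S w)%:E + ((4 * t)^-1)%:E * (L w ^+ 2)%:E)%E).
      exact: emeasurable_funD.
    by move=> w; rewrite adde_ge0.
  move=> u _; apply: ge0_le_integral => //.
  - by move=> z _; rewrite mule_ge0// lee_fin.
  - by apply: (m2 (fun w => (\1_S w)%:E * (L w)%:E)%E).
  - apply: (m2 (fun w => t%:E * (\1_S w)%:E + ((4 * t)^-1)%:E * (L w ^+ 2)%:E)%E).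
    exact: emeasurable_funD.
  move=> z _; rewrite -!EFinM -EFinD lee_fin indicE.
  case: (_ \in S); last by rewrite mul0r mulr0 add0r mulr_ge0// sqr_ge0.
  rewrite mul1r mulr1 -subr_ge0.
  rewrite (_ : _ - _ = (L (u, z) - 2 * t) ^+ 2 / (4 * t)).
    by rewrite divr_ge0 ?sqr_ge0//; lra.
  by field; rewrite gt_eqF.
under eq_integral => u _.
  rewrite ge0_integralD//; last 2 first.
  - by apply: (m2 (fun w => t%:E * (\1_S w)%:E)%E).
  - by apply: (m2 (fun w => ((4 * t)^-1)%:E * (L w ^+ 2)%:E)%E).
  rewrite ge0_integralZl//; last 2 first.
  - by apply: (m2 (fun w => (\1_S w)%:E)); exact: mI.
  - by rewrite lee_fin ltW.
  rewrite ge0_integralZl//; last first.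
  - by apply: (m2 (fun w => (L w ^+ 2)%:E)).
  over.
have mF1 := mF (fun w => (\1_S w)%:E) (mI _ mS) (fun w => ltac:(by rewrite lee_fin)).
have mF2 := mF (fun w => (L w ^+ 2)%:E) mL2 L20.
rewrite ge0_integralD//; last 4 first.
- by move=> u _; rewrite mule_ge0 ?lee_fin ?(ltW t0)//; apply: integral_ge0 => z _; rewrite lee_fin.
- exact: emeasurable_funM.
- by move=> u _; rewrite mule_ge0 ?lee_fin//; apply: integral_ge0.
- exact: emeasurable_funM.
rewrite ge0_integralZl//; last 2 first.
- by move=> u _; apply: integral_ge0 => z _; rewrite lee_fin.
- by rewrite lee_fin ltW.
rewrite -indE// ge0_integralZl//; last by move=> u _; apply: integral_ge0.
apply: leeD => //; apply: lee_wpmul2l; first by rewrite lee_fin.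
(* Given u, the second moment of [L] is the product of the exp(g_i(u_i)^2 / s^2); independence of
   the locations turns its mean into a product of integrals. *)
rewrite -integral_tprob_prod//.
- rewrite le_eqVlt; apply/orP; left; apply/eqP.
  apply: eq_integral => u _.
  rewrite -prodEFin.
  under eq_bigr => i _ do rewrite -integral_gauss_ratio_sqr//.
  rewrite -(integral_tprob_prod (gauss s) (fun i x => gauss_ratio s (g i (tnth u i)) x ^+ 2)).
  + by apply: eq_integral => z _; rewrite /L prodrXl.
  + by move=> i; apply: measurable_funX; exact: measurable_gauss_ratio.
  + by move=> i x; rewrite sqr_ge0.
- move=> i; apply: measurableT_comp => //; apply: measurable_funM => //.
  exact: measurable_funX.
Qed.

End gaussian_shift.

Arguments design_noise {d V R} mu s N.
Arguments shift {d V R N} g w.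
Arguments design_noise_shift_le {d V R} mu {s N} g S t.

(** * Generated sigma-algebras and independence of coordinates *)

Lemma continuous_borel_measurable (R : realType) (U : ptopologicalType)
    (f : U -> R) :
  continuous f -> measurable_fun [set: borel U] (f : borel U -> R).
Proof.
move=> /continuousP cf.
apply: (measurability _ (RGenOpens.measurableE R)) => _ [_ [a [b ->] <-]].
rewrite setTI; apply: sub_sigma_algebra; apply: cf.
exact: interval_open.
Qed.

Lemma sigma_algebra_preimage_measurable d d' (T : measurableType d)
    (E : measurableType d') (c : T -> E) :
  sigma_algebra setT (preimage_set_system setT c measurable).
Proof.
split.
- by exists set0 => //; rewrite preimage_set0 setI0.
- move=> _ [B mB <-]; exists (~` B); first exact: measurableC.
  by rewrite !setTI setTD preimage_setC.
- move=> F FP.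
  have /choice[B BP] : forall k, exists B, measurable B /\ c @^-1` B = F k.
    by move=> k; have [B mB <-] := FP k; exists B; rewrite setTI.
  exists (\bigcup_k B k); first by apply: bigcupT_measurable => k; case: (BP k).
  by rewrite setTI preimage_bigcup; apply: eq_bigcupr => k _; case: (BP k).
Qed.

(** Events of a process that factors through c are events of c. This reduces every independence
    claim on processes to one on the coordinates of the product space. *)
Lemma family_sigma_factor d d' d'' (Om : measurableType d) (T : Type)
    (E : measurableType d') (E' : measurableType d'') (Z : T -> Om -> E)
    (c : Om -> E') :
  (forall t, exists2 h, measurable_fun setT h & forall w, Z t w = h (c w)) ->
  forall A, family_sigma Z A -> exists2 B, measurable B & A = c @^-1` B.
Proof.
move=> Zc A ZA.
have [||B mB <-] := @smallest_sub _ _ _ (preimage_set_system setT c measurable) _ _ A ZA.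
- exact: sigma_algebra_preimage_measurable.
- move=> _ [t _ [B mB <-]]; have [h mh Zh] := Zc t.
  exists (h @^-1` B); first by rewrite -[X in measurable X]setTI; exact: mh.
  by rewrite !setTI; apply/seteqP; split=> w /=; rewrite Zh.
- by exists B => //; rewrite setTI.
Qed.

Section coordinates.
Context d (T : measurableType d) (R : realType) (P : probability T R) (N : nat).
Variables (I : finType) (r : I -> 'I_N).

Lemma measurable_tnth_preimage (j : 'I_N) (B : set T) : measurable B ->
  measurable [set t : N.-tuple T | B (tnth t j)].
Proof. by move=> mB; have := measurable_tnth j measurableT mB; rewrite setTI. Qed.

Lemma tprob_coordinates (J : {set I}) (B : I -> set T) : injective r ->
  (forall i, i \in J -> measurable (B i)) ->
  tprob P N (\bigcap_(i in [set` J]) [set t | B i (tnth t (r i))])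
  = (\prod_(i in J) P (B i))%E.
Proof.
move=> r_inj mB.
(* The value [setT] leaves free the coordinates that no index of J uses. *)
pose B' j := if [pick i in J | r i == j] is Some i then B i else setT.
have B'r i : i \in J -> B' (r i) = B i.
  move=> iJ; rewrite /B'; case: pickP => [k /andP[_ /eqP/r_inj ->]//|/(_ i)].
  by rewrite iJ eqxx.
have mB' j : measurable (B' j).
  by rewrite /B'; case: pickP => // k /andP[kJ _]; exact: mB.
rewrite (_ : \bigcap_(i in _) _ = \bigcap_j [set t | B' j (tnth t j)]); last first.
  apply/seteqP; split=> t /= tB.
  - move=> j _ /=; rewrite /B'; case: pickP => // k /andP[kJ /eqP <-].
    exact: tB.
  - by move=> i iJ /=; rewrite -B'r//; exact: tB.
rewrite tprob_bigcap//.
rewrite [LHS](bigID (mem (imset r (mem J))))/= [X in (_ * X)%E]big1 ?mule1.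
  rewrite big_imset/=; last by move=> i k _ _ /r_inj.
  by apply: eq_bigr => i iJ; rewrite B'r.
move=> j jJ; rewrite /B'; case: pickP => [k /andP[kJ /eqP kj]|_].
  by move: jJ; rewrite -kj imset_f.
exact: probability_setT.
Qed.

End coordinates.

Arguments tprob_coordinates {d T R} P {N I} r J B.

Lemma tprob_coordinate d (T : measurableType d) (R : realType)
    (P : probability T R) N (j : 'I_N) (B : set T) : measurable B ->
  tprob P N [set t | B (tnth t j)] = P B.
Proof.
move=> mB; have := tprob_coordinates P (fun _ : unit => j) [set tt] (fun=> B).
rewrite big_set1 => <-//; last by move=> [] [].
congr (tprob P N _); apply/seteqP; split=> t /=; first by move=> tB.
by move=> /(_ tt); apply; rewrite /= inE.
Qed.

Arguments tprob_coordinate {d T R} P {N} j {B}.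

Section design_noise_theory.
Context d (V : measurableType d) (R : realType) (mu : probability V R).
Variables (s : R) (N : nat).
Local Notation P := (design_noise mu s N).
Local Notation Om := (N.-tuple V * N.-tuple R)%type.

Lemma design_noiseX (A : set (N.-tuple V)) (B : set (N.-tuple R)) :
  measurable A -> measurable B ->
  P (fst @^-1` A `&` snd @^-1` B) = (tprob mu N A * tprob (gauss s) N B)%E.
Proof. by move=> mA mB; rewrite -product_measure1E. Qed.

Lemma design_noise_fst (A : set (N.-tuple V)) : measurable A ->
  P (fst @^-1` A) = tprob mu N A.
Proof.
move=> mA; rewrite -(setIT (fst @^-1` A)) -(preimage_setT (@snd (N.-tuple V) _)).
by rewrite design_noiseX// probability_setT mule1.
Qed.

Lemma design_noise_snd (B : set (N.-tuple R)) : measurable B ->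
  P (snd @^-1` B) = tprob (gauss s) N B.
Proof.
move=> mB; rewrite -(setTI (snd @^-1` B)) -(preimage_setT (@fst _ (N.-tuple R))).
by rewrite design_noiseX// probability_setT mul1e.
Qed.

Variable j : 'I_N.

Definition location (w : Om) : V := tnth w.1 j.
Definition noise (w : Om) : R := tnth w.2 j.

Lemma measurable_location : measurable_fun setT location.
Proof. exact: (measurableT_comp (measurable_tnth j) measurable_fst). Qed.

Lemma measurable_noise : measurable_fun setT noise.
Proof. exact: (measurableT_comp (measurable_tnth j) measurable_snd). Qed.

HB.instance Definition _ :=
  isMeasurableFun.Build _ _ _ _ location measurable_location.
HB.instance Definition _ := isMeasurableFun.Build _ _ _ _ noise measurable_noise.

Definition scaled_noise (a : R) (w : Om) : R := a * noise w.

Lemma measurable_scaled_noise a : measurable_fun setT (scaled_noise a).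
Proof. by apply: measurable_funM => //; exact: measurable_noise. Qed.

HB.instance Definition _ a :=
  isMeasurableFun.Build _ _ _ _ (scaled_noise a) (measurable_scaled_noise a).

Lemma design_noise_location (A : set V) : measurable A ->
  P (location @^-1` A) = mu A.
Proof.
move=> mA; rewrite -[RHS](tprob_coordinate mu j)//.
by rewrite -design_noise_fst//; exact: measurable_tnth_preimage.
Qed.

Lemma design_noise_noise (A : set R) : measurable A ->
  P (noise @^-1` A) = gauss s A.
Proof.
move=> mA; rewrite -[RHS](tprob_coordinate (gauss s) j)//.
by rewrite -design_noise_snd//; exact: measurable_tnth_preimage.
Qed.

Lemma ge0_integral_noise (f : R -> \bar R) :
  measurable_fun setT f -> (forall x, 0 <= f x)%E ->
  (\int[P]_w f (noise w) = \int[gauss s]_x f x)%E.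
Proof.
move=> mf f0; rewrite -(ge0_integral_distribution (noise : {RV P >-> R}))//.
by apply: eq_measure_integral => A mA _; exact: design_noise_noise.
Qed.

Lemma noise_integrable : s != 0 ->
  (P : probability _ _).-integrable setT (fun w => (noise w)%:E).
Proof.
move=> s0; have /integrableP[_ fin] := gauss_integrable s s0.
apply/integrableP; split; first by apply/measurable_EFinP; exact: measurable_noise.
rewrite (ge0_integral_noise (fun x => `|x%:E|%E))//.
by apply: measurableT_comp => //; exact/measurable_EFinP.
Qed.

Lemma noise_mean : s != 0 -> (\int[P]_w (noise w)%:E = 0)%E.
Proof.
move=> s0; rewrite -[RHS](gauss_mean s s0).
have mE : measurable_fun [set: R] (fun x : R => x%:E : \bar R).
  exact/measurable_EFinP.
have /= <- := integral_distribution (X := noise : {RV P >-> R}) mE (noise_integrable s0).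
by apply: eq_measure_integral => A mA _; exact: design_noise_noise.
Qed.

Lemma scaled_noise_centered (a M : R) : s != 0 ->
  8 * expR (2^-1) * s ^+ 2 * a ^+ 2 <= M ->
  centered_var_le (P : probability _ _) (scaled_noise a) M.
Proof.
move=> s0 aM; have E0 : ('E_P[scaled_noise a] = 0)%E.
  rewrite unlock; under eq_integral do rewrite EFinM.
  by rewrite integralZl//; [rewrite noise_mean// mule0|exact: noise_integrable].
split => //.
  rewrite (_ : _ \o _ = (fun w => a%:E * (noise w)%:E)%E); last first.
    by apply/funext => w /=; rewrite EFinM.
  by apply: integrableZl => //; exact: noise_integrable.
rewrite /variance covariance.unlock E0/= unlock.
rewrite (_ : (\int[P]_w _)%E = (\int[P]_w ((a ^+ 2)%:E * (noise w ^+ 2)%:E))%E); last first.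
  apply: eq_integral => w _.
  transitivity ((a * noise w - 0) * (a * noise w - 0))%:E => //.
  by rewrite -EFinM; congr EFin; ring.
rewrite ge0_integralZl//; last 3 first.
- by apply/measurable_EFinP; apply: measurable_funX; exact: measurable_noise.
- by move=> w _; rewrite lee_fin sqr_ge0.
- by rewrite lee_fin sqr_ge0.
rewrite (ge0_integral_noise (fun x => (x ^+ 2)%:E)); last 2 first.
- by apply/measurable_EFinP; exact: measurable_funX.
- by move=> x; rewrite lee_fin sqr_ge0.
apply: le_trans (_ : (a ^+ 2)%:E * (8 * expR (2^-1) * s ^+ 2)%:E <= _)%E.
  by apply: lee_wpmul2l; rewrite ?lee_fin ?sqr_ge0//; exact: gauss_second_moment.
by rewrite -EFinM lee_fin mulrC.
Qed.

End design_noise_theory.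

Arguments location {d V R N} j w.
Arguments noise {d V R N} j w.
Arguments scaled_noise {d V R N} j a w.

Section coordinate_families.
Context d (V : measurableType d) (R : realType) (mu : probability V R).
Variables (s : R) (N : nat).
Local Notation P := (design_noise mu s N).
Local Notation Om := (N.-tuple V * N.-tuple R)%type.
Variables (I : finType) (r : I -> 'I_N).
Hypothesis r_inj : injective r.

(** F is left abstract so that any generated sigma-algebra fits, provided that its events at the
    index i depend on the coordinate [r i] only; [family_sigma_factor] supplies this. *)
Lemma location_independent (F : I -> set (set Om)) :
  (forall i A, F i A -> exists2 B, measurable B & A = location (r i) @^-1` B) ->
  mutually_independent P F.
Proof.
move=> FP J A FA.
have /choice[B BP] i : exists B, i \in J ->
    measurable B /\ A i = location (r i) @^-1` B.
  have [iJ|iJ] := boolP (i \in J); last by exists set0.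
  by have [B mB ->] := FP _ _ (FA i iJ); exists B.
have mB i : i \in J -> measurable (B i) by move=> /BP[].
rewrite (_ : \bigcap_(i in _) _ =
    fst @^-1` (\bigcap_(i in [set` J]) [set t | B i (tnth t (r i))])).
  rewrite design_noise_fst; last first.
    by apply: fin_bigcap_measurable => // i iJ; apply: measurable_tnth_preimage; exact: mB.
  rewrite tprob_coordinates//; apply: eq_bigr => i iJ.
  by have [_ ->] := BP _ iJ; rewrite design_noise_location//; exact: mB.
by rewrite preimage_bigcap; apply: eq_bigcapr => i iJ; have [_ ->] := BP _ iJ.
Qed.

Lemma noise_independent (F : I -> set (set Om)) :
  (forall i A, F i A -> exists2 B, measurable B & A = noise (r i) @^-1` B) ->
  mutually_independent P F.
Proof.
move=> FP J A FA.
have /choice[B BP] i : exists B, i \in J ->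
    measurable B /\ A i = noise (r i) @^-1` B.
  have [iJ|iJ] := boolP (i \in J); last by exists set0.
  by have [B mB ->] := FP _ _ (FA i iJ); exists B.
have mB i : i \in J -> measurable (B i) by move=> /BP[].
rewrite (_ : \bigcap_(i in _) _ =
    snd @^-1` (\bigcap_(i in [set` J]) [set t | B i (tnth t (r i))])).
  rewrite design_noise_snd; last first.
    by apply: fin_bigcap_measurable => // i iJ; apply: measurable_tnth_preimage; exact: mB.
  rewrite tprob_coordinates//; apply: eq_bigr => i iJ.
  by have [_ ->] := BP _ iJ; rewrite design_noise_noise//; exact: mB.
by rewrite preimage_bigcap; apply: eq_bigcapr => i iJ; have [_ ->] := BP _ iJ.
Qed.

Lemma noise_same_law (T : Type) d' (E : measurableType d') (h : T -> R -> E)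
    (j k : 'I_N) : (forall t, measurable_fun setT (h t)) ->
  same_law P (fun t w => h t (noise j w)) (fun t w => h t (noise k w)).
Proof.
move=> mh M t B mB.
pose S := \bigcap_(i : 'I_M) (h (t i) @^-1` B i).
have mS : measurable S.
  by apply: fin_bigcap_measurable => // i _; rewrite -[X in measurable X]setTI; exact: mh.
have SE l : \bigcap_i ((fun w => h (t i) (noise l w)) @^-1` B i) =
    (noise l : Om -> R) @^-1` S by rewrite preimage_bigcap.
by rewrite !SE !design_noise_noise.
Qed.

End coordinate_families.

Arguments location_independent {d V R} mu s {N I} r.
Arguments noise_independent {d V R} mu s {N I} r.
Arguments noise_same_law {d V R} mu s {N T d' E} h j k.
Arguments continuous_borel_measurable {R U f}.

(** * The noise models *)

Section L2_tools.
Context (R : realType) (U : ptopologicalType) (mu : probability (borel U) R).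

Lemma normL2_sqr (f : U -> R) :
  (normL2 mu f ^+ 2 = \int[mu]_(x in [set: borel U]) (f x ^+ 2)%:E)%E.
Proof.
have sqrE (y : \bar R) : (0 <= y -> y ^+ 2 = y `^ 2)%E.
  case: y => [r|_|//]; last by rewrite poweRyr //= mulyy.
  by rewrite lee_fin => r0; rewrite poweR_EFin powR_mulrn.
rewrite sqrE ?Lnorm_ge0// powR_Lnorm//.
by apply: eq_integral => x _ /=; rewrite powR_mulrn// real_normK// num_real.
Qed.

Lemma inL2_measurable (f : U -> R) : inL2 mu f -> measurable_fun setT (f : borel U -> R).
Proof. by move=> /sub_Lfun_mfun; rewrite inE. Qed.

Lemma inL2_sqr_lty (f : U -> R) :
  measurable_fun [set: borel U] (f : borel U -> R) ->
  (\int[mu]_(x in [set: borel U]) (f x ^+ 2)%:E < +oo)%E -> inL2 mu f.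
Proof.
move=> mf fin; rewrite /inL2; apply/andP; split; rewrite inE//.
rewrite /= /finite_norm.
have := normL2_sqr f; rewrite /normL2.
case: ('N[mu]_2%:E[_])%E (Lnorm_ge0 mu 2%:E (EFin \o f)) => [r _ _|_|//].
  exact: ltry.
by rewrite /= mulyy => h; move: fin; rewrite -h.
Qed.

Lemma bounded_inL2 (f : U -> R) (B : R) :
  measurable_fun [set: borel U] (f : borel U -> R) ->
  (forall x, `|f x| <= B) -> inL2 mu f.
Proof.
move=> mf fB; apply: inL2_sqr_lty => //.
apply: (@le_lt_trans _ _ (\int[mu]_(x in [set: borel U]) (B ^+ 2)%:E)%E).
  apply: ge0_le_integral => //.
  - by move=> x _; rewrite lee_fin sqr_ge0.
  - by apply/measurable_EFinP; exact: measurable_funX.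
  move=> x _; rewrite lee_fin -real_normK ?num_real//.
  by rewrite lerXn2r// ?nnegrE ?normr_ge0// (le_trans _ (fB x)).
rewrite integral_cst//; apply: lte_mul_pinfty; rewrite ?lee_fin ?sqr_ge0//.
exact: le_lt_trans (probability_le1 mu measurableT) (ltry _).
Qed.

End L2_tools.

Section noise_model.
Context (R : realType) (U : ptopologicalType) (mu : probability (borel U) R).
Context (p L n : nat) (m : 'I_n -> nat).
Variables (q0 : 'I_p) (m_ge1 : forall i, (1 <= m i)%N).
Variables (s : R) (e : U -> R) (kap : bool).
Local Notation N := #|obs m|.
Local Notation P := (design_noise mu s N).
Local Notation Om := (N.-tuple (borel U) * N.-tuple R)%type.

(** The process eps_i needs one Gaussian variable per curve. It borrows the noise coordinate of the
    first observation of the curve, so that both kinds of model live on the same product space. *)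
Definition first_obs (i : 'I_n) : obs m := Tagged _ (Ordinal (m_ge1 i)).

Lemma first_obs_inj : injective (enum_rank \o first_obs).
Proof. by move=> i k /= /enum_rank_inj/(congr1 tag). Qed.

(* The noise is carried either by the processes eps_i = z_(i, 1) e
   (when [kap] is false) or by the measurement errors delta_ij = z_ij. *)
Definition noise_model (b : U -> R) : model R U p L m :=
  @Model R U p L n m _ Om P
    (fun i _ w x => noise (enum_rank (first_obs i)) w * e x)
    (fun o => location (enum_rank o))
    (fun o _ => scaled_noise (enum_rank o) kap%:R)
    (fun _ q x => (q == q0)%:R * b x).

Variables (tau : nat -> R) (v : nat -> U -> R) (Mdelta Meps M0 Be : R).
Hypothesis s_neq0 : s != 0.
Hypothesis e_cont : continuous e.
Hypothesis e_bounded : forall x, `|e x| <= Be.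
Hypothesis kap_e : kap -> forall x, e x = 0.
Hypothesis s_delta : 8 * expR (2^-1) * s ^+ 2 <= Mdelta.
Hypothesis s_eps : 8 * expR (2^-1) * s ^+ 2 * Be ^+ 2 <= Meps.

Lemma noise_model_loc_ok (b : U -> R) : loc_ok mu (noise_model b).
Proof.
split.
- apply: (location_independent mu s enum_rank); first exact: enum_rank_inj.
  move=> o A; apply: family_sigma_factor => -[]; exists id => //.
- exists (cst 1), 1, 1; split=> //; first by move=> x; rewrite !lexx.
  move=> o A mA; rewrite (integral_cst mu mA 1%E) mul1e.
  exact: design_noise_location.
Qed.

Lemma noise_model_delta_ok (b : U -> R) : delta_ok Mdelta (noise_model b).
Proof.
split; [split|].
- apply: (noise_independent mu s enum_rank); first exact: enum_rank_inj.
  move=> o A; apply: family_sigma_factor => l.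
  by exists (fun x => kap%:R * x) => //; exact: measurable_funM.
- move=> o o'.
  apply: (noise_same_law mu s (fun (_ : 'I_L) x => kap%:R * x)).
  by move=> _; exact: measurable_funM.
- move=> o l; apply: scaled_noise_centered => //.
  by apply: le_trans s_delta; case: kap; rewrite ?expr1n ?mulr1// expr0n mulr0 //;
    rewrite mulr_ge0 ?sqr_ge0// mulr_ge0 ?expR_ge0.
Qed.

Lemma noise_model_eps_ok (b : U -> R) : eps_ok mu Meps (noise_model b).
Proof.
have me := continuous_borel_measurable e_cont.
split.
- move=> i l w /=; apply: (@bounded_inL2 _ _ _ _ (`|noise (enum_rank (first_obs i)) w| * Be)).
    exact: measurable_funM.
  by move=> x; rewrite normrM ler_wpM2l.
- move=> i l /=.
  (* The Gaussian factor must be measurable for the sigma-algebra of the process itself. It is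
     recovered from the value of the process at a point x0 with [e x0] nonzero; without such a point
     the process is identically 0. *)
  have [e0|] := pselect (forall x, e x = 0).
    rewrite (_ : (fun z => _) = cst 0); first exact: measurable_cst.
    by apply/funext => z; rewrite e0 mulr0.
  move=> /existsNP[x0 /eqP ex0].
  pose Z := @eps_process R U p L n m (noise_model b) i.
  pose G := g_sigma_algebraType (family_sigma Z).
  have mZ : measurable_fun [set: G] (Z (l, x0) : G -> R).
    move=> _ B mB; rewrite setTI; apply: sub_sigma_algebra; apply: sub_sigma_algebra.
    by exists (l, x0) => //; exists B => //; rewrite setTI.
  have mg : measurable_fun [set: G] (fun w : G => Z (l, x0) w / e x0).
    exact: measurable_funM.
  apply: measurable_funM; last exact: (measurableT_comp me measurable_snd).
  rewrite (_ : (fun z => _) = (fun w : G => Z (l, x0) w / e x0) \o fst); last first.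
    by apply/funext => z /=; rewrite /Z /eps_process /= mulfK.
  exact: (measurableT_comp mg measurable_fst).
- by move=> i l x /=; apply: measurable_funM.
- split.
  + apply: (noise_independent mu s (enum_rank \o first_obs)); first exact: first_obs_inj.
    move=> i A; apply: family_sigma_factor => -[l x].
    by exists (fun y => y * e x) => //; exact: measurable_funM.
  + move=> i i'.
    apply: (noise_same_law mu s (fun (lx : 'I_L * U) y => y * e lx.2)).
    by move=> lx; exact: measurable_funM.
- move=> i l x /=.
  rewrite (_ : (fun w => _) = scaled_noise (enum_rank (first_obs i)) (e x)); last first.
    by apply/funext => w; rewrite /scaled_noise mulrC.
  apply: scaled_noise_centered => //; apply: le_trans s_eps.
  apply: ler_wpM2l; first by rewrite mulr_ge0 ?sqr_ge0// mulr_ge0 ?expR_ge0.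
  rewrite -real_normK ?num_real// lerXn2r ?nnegrE//.
  exact: le_trans (e_bounded x).
Qed.

(** The processes and the measurement errors are built on the same noise coordinates. They are
    independent because [kap] switches one of them off, which makes its sigma-algebra trivial; there
    remains the independence of locations and noise. *)
Lemma noise_model_independent_families (b : U -> R) :
  independent_families (noise_model b).
Proof.
have triv (D : set Om) : (exists2 B : set unit, measurable B & D = (fun=> tt) @^-1` B) ->
    D = set0 \/ D = setT.
  move=> [B _ ->]; have [Bt|Bt] := pselect (B tt).
    by right; apply/seteqP; split.
  by left; apply/seteqP; split.
move=> A B C sA sB sC.
have [B' mB' BE] : exists2 B', measurable B' & B = fst @^-1` B'.
  move: sB; apply: family_sigma_factor => o.
  by exists (fun u => tnth u (enum_rank o)) => //; exact: measurable_tnth.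
have [A' mA' AE] : exists2 A', measurable A' & A = snd @^-1` A'.
  move: sA; apply: family_sigma_factor => -[i [l x]].
  exists (fun z => tnth z (enum_rank (first_obs i)) * e x) => //.
  by apply: measurable_funM => //; exact: measurable_tnth.
have [C' mC' CE] : exists2 C', measurable C' & C = snd @^-1` C'.
  move: sC; apply: family_sigma_factor => -[ij l].
  exists (fun z => kap%:R * tnth z (enum_rank ij)) => //.
  by apply: measurable_funM => //; exact: measurable_tnth.
have PXY (D : set (N.-tuple R)) : measurable D ->
    P (snd @^-1` D `&` fst @^-1` B') = (P (snd @^-1` D) * P (fst @^-1` B'))%E.
  move=> mD; rewrite setIC design_noiseX// design_noise_fst// design_noise_snd//.
  by rewrite muleC.
change (P (A `&` B `&` C) = (P A * P B * P C)%E).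
have [kapT|kapF] := boolP kap.
- have [->|->] : A = set0 \/ A = setT.
  + apply: triv; move: sA; apply: family_sigma_factor => -[i [l x]].
    exists (cst 0) => // w; rewrite /eps_process /= kap_e// mulr0//.
  + by rewrite !set0I measure0 !mul0e.
  + by rewrite setTI probability_setT mul1e setIC BE CE PXY// muleC.
- have [->|->] : C = set0 \/ C = setT.
  + apply: triv; move: sC; apply: family_sigma_factor => -[ij l].
    by exists (cst 0) => // w; rewrite /= /scaled_noise (negbTE kapF) mul0r.
  + by rewrite !setI0 measure0 !mule0.
  + by rewrite setIT probability_setT mule1 AE BE PXY.
Qed.

Lemma noise_model_admissible (b : U -> R) :
  in_rkhs mu tau v b -> rkhs_norm mu tau v b <= M0 ->
  in_rkhs mu tau v (cst 0) -> rkhs_norm mu tau v (cst 0) <= M0 ->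
  admissible mu tau v Mdelta Meps M0 (noise_model b).
Proof.
move=> b_rkhs bM0 z_rkhs zM0; split.
- exact: noise_model_loc_ok.
- exact: noise_model_delta_ok.
- exact: noise_model_eps_ok.
- exact: noise_model_independent_families.
- move=> l q; rewrite /beta_ok /=; case: (q == q0).
    by rewrite (_ : (fun x => _) = b)//; apply/funext => x; rewrite mul1r.
  by rewrite (_ : (fun x => _) = cst 0)//; apply/funext => x; rewrite mul0r.
Qed.

End noise_model.

Arguments first_obs {n m} m_ge1 i.
Arguments noise_model {R U} mu {p} L {n m} q0 m_ge1 s e kap b.
Arguments noise_model_admissible {R U mu p L n m q0 m_ge1 s e kap tau v Mdelta Meps M0} Be.

(** * Testing many hypotheses *)

(** From (f - g)^2 <= 2 (a - f)^2 + 2 (a - g)^2. An estimate close to two hypotheses forces them to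
    be close to each other, which limits how many success events can hold at once. *)
Lemma L2_ball_diameter (R : realType) (U : ptopologicalType)
    (mu : probability (borel U) R) (a f g : U -> R) (r : R) : 0 <= r ->
  inL2 mu a -> inL2 mu f -> inL2 mu g ->
  (normL2 mu (fun x => a x - f x)%R <= (Num.sqrt r)%:E)%E ->
  (normL2 mu (fun x => a x - g x)%R <= (Num.sqrt r)%:E)%E ->
  (\int[mu]_(x in [set: borel U]) ((f x - g x) ^+ 2)%:E <= (4 * r)%:E)%E.
Proof.
move=> r0 /inL2_measurable ma /inL2_measurable mf /inL2_measurable mg.
have sq (k : U -> R) : (normL2 mu k <= (Num.sqrt r)%:E)%E ->
    (\int[mu]_(x in [set: borel U]) (k x ^+ 2)%:E <= r%:E)%E.
  move=> kr; rewrite -normL2_sqr -[X in (_ <= X%:E)%E]sqr_sqrtr// EFin_expe.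
  by rewrite !expe2; apply: lee_pmul => //; exact: Lnorm_ge0.
move=> /sq hf /sq hg.
have m2 (k l : borel U -> R) : measurable_fun setT k -> measurable_fun setT l ->
    measurable_fun setT (fun x => ((k x - l x) ^+ 2)%:E).
  by move=> mk ml; apply/measurable_EFinP/measurable_funX; exact: measurable_funB.
have p2 (k l : borel U -> R) x : (0 <= ((k x - l x) ^+ 2)%:E)%E.
  by rewrite lee_fin sqr_ge0.
apply: (@le_trans _ _ (\int[mu]_(x in [set: borel U])
   (2%:E * ((a x - f x) ^+ 2)%:E + 2%:E * ((a x - g x) ^+ 2)%:E))%E).
  apply: ge0_le_integral => //.
  - exact: m2.
  - by apply: emeasurable_funD; apply: emeasurable_funM => //; exact: m2.
  move=> x _; rewrite -!EFinM -EFinD lee_fin.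
  by have := sqr_ge0 ((a x - f x) + (a x - g x)); nra.
rewrite ge0_integralD//; last 4 first.
- by move=> x _; rewrite mule_ge0.
- by apply: emeasurable_funM => //; exact: m2.
- by move=> x _; rewrite mule_ge0.
- by apply: emeasurable_funM => //; exact: m2.
rewrite !ge0_integralZl//; [|exact: m2|exact: m2].
apply: (@le_trans _ _ (2%:E * r%:E + 2%:E * r%:E)%E).
  by apply: leeD; apply: lee_wpmul2l.
by rewrite -!EFinM -EFinD lee_fin; lra.
Qed.

Lemma excess_risk_le_normL2 (R : realType) (U : ptopologicalType)
    (mu : probability (borel U) R) (p L : nat) (bhat beta : 'I_L -> 'I_p -> U -> R)
    (l : 'I_L) (q : 'I_p) (r : R) : 0 <= r ->
  (excess_risk mu bhat beta <= r%:E)%E ->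
  (normL2 mu (fun x => bhat l q x - beta l q x)%R <= (Num.sqrt r)%:E)%E.
Proof.
move=> r0; set nr := normL2 _ _ => er.
have n0 : (0 <= nr)%E by exact: Lnorm_ge0.
have : (nr ^+ 2 <= r%:E)%E.
  apply: le_trans er; rewrite /excess_risk (bigD1 q)//= (bigD1 l)//= -/nr -addeA.
  have t0 k j : (0 <= normL2 mu (fun x => (bhat k j x - beta k j x)%R) ^+ 2)%E.
    by rewrite expe_ge0// Lnorm_ge0.
  rewrite leeDl//; apply: adde_ge0; apply: sume_ge0 => j _; first exact: t0.
  by apply: sume_ge0 => k _; exact: t0.
case: nr n0 => [x| _|].
- rewrite -EFin_expe !lee_fin => x0 xr.
  by rewrite -(ger0_norm x0) -sqrtr_sqr ler_wsqrtr.
- by rewrite /= mulyy leye_eq.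
- by rewrite leeNy_eq.
Qed.

Arguments L2_ball_diameter {R U mu a f g r}.
Arguments excess_risk_le_normL2 {R U mu p L bhat beta} l q {r}.

Section many_hypotheses.
Context (R : realType) (U : ptopologicalType) (mu : probability (borel U) R).
Context (p L n : nat) (m : 'I_n -> nat) (X : 'M[R]_(n, p)).
Variables (q0 : 'I_p) (l0 : 'I_L) (m_ge1 : forall i, (1 <= m i)%N).
Variables (s : R) (e : U -> R) (kap : bool).
Hypothesis e_cont : continuous e.
Local Notation N := #|obs m|.
Local Notation P := (design_noise mu s N).
Local Notation Om := (N.-tuple (borel U) * N.-tuple R)%type.
Local Notation Mod b := (noise_model mu L q0 m_ge1 s e kap b).

(** Checked on generators: the evaluation of b or e at a random location is measurable because these
    functions are continuous. *)
Lemma measurable_model_data (b : U -> R) (E : set (data R U p L m)) :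
  continuous b -> data_measurable E ->
  measurable [set w : Om | E (model_data X (M := Mod b) w)].
Proof.
move=> b_cont; have mb := continuous_borel_measurable b_cont.
have me := continuous_borel_measurable e_cont.
have gen d' (T : measurableType d') (f : data R U p L m -> T) :
    measurable_fun setT (fun w : Om => f (model_data X (M := Mod b) w)) ->
    forall B, measurable B ->
    measurable [set w : Om | ([set: data R U p L m] `&` f @^-1` B)
      (model_data X (M := Mod b) w)].
  move=> mf B mB; rewrite setTI.
  by have := mf measurableT B mB; rewrite setTI.
move: E; apply: smallest_sub.
  split.
  - by rewrite (_ : [set w | _] = set0)//; exact: measurable0.
  - by move=> A mA; rewrite setTD; exact: measurableC.
  - move=> F mF; rewrite (_ : [set w | _] =
      \bigcup_k [set w : Om | F k (model_data X (M := Mod b) w)])//.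
    exact: bigcupT_measurable.
have ml (o : obs m) : measurable_fun setT
   (fun w : Om => location (enum_rank o) w : borel U) by exact: measurable_location.
move=> A [[|]|].
- move=> [[ij l] _ [B mB <-]]; apply: (gen _ R (fun D => dataY D ij l)) => //=.
  rewrite /response /=.
  apply: measurable_funD; [apply: measurable_funD|].
  + apply: measurable_sum => q; apply: measurable_funM => //.
    by apply: measurable_funM => //; exact: (measurableT_comp mb (ml _)).
  + apply: measurable_funM; first exact: measurable_noise.
    exact: (measurableT_comp me (ml _)).
  + exact: measurable_scaled_noise.
- by move=> [ij _ [B mB <-]]; apply: (gen _ (borel U) (fun D => dataU D ij)).
- by move=> [[i q] _ [B mB <-]]; apply: (gen _ R (fun D => dataX D i q)).
Qed.

Variable bhat : estimator p L m mu.

Lemma measurable_success (b : U -> R) (r : R) : continuous b -> inL2 mu b ->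
  measurable [set w : Om | (excess_risk mu (bhat (model_data X (M := Mod b) w))
    (beta (Mod b)) <= r%:E)%E].
Proof.
move=> b_cont bL2.
have mn l q : measurable_fun setT (fun w : Om =>
   normL2 mu (fun x => (bhat (model_data X (M := Mod b) w) l q x
     - beta (Mod b) l q x)%R)).
  apply: (measurability _ (ErealGenOInfty.measurableE R)) => _ [_ [y ->] <-].
  rewrite setTI (_ : _ @^-1` _ = ~` [set w : Om |
    (normL2 mu (fun x => (bhat (model_data X (M := Mod b) w) l q x
     - beta (Mod b) l q x)%R) <= y%:E)%E]); last first.
    by apply/seteqP; split=> w /=; rewrite in_itv/= andbT ltNge => /negP.
  apply: measurableC.
  apply: (measurable_model_data _ [set D | (normL2 mu (fun x => (bhat D l q x
     - beta (Mod b) l q x)%R) <= y%:E)%E]) => //.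
  apply: estim_measurable; rewrite /= /inL2.
  by rewrite (_ : (fun x => _) = ((q == q0)%:R \o* (b : borel U -> R)))
    ?Lfun_scale ?ler1n//; apply/funext => x; rewrite /= mulrC.
have mr : measurable_fun setT (fun w : Om =>
   excess_risk mu (bhat (model_data X (M := Mod b) w)) (beta (Mod b))).
  apply: emeasurable_sum => q; apply: emeasurable_sum => l.
  exact: (emeasurable_funM (mn l q) (mn l q)).
have := mr measurableT [set y | y <= r%:E]%E.
rewrite setTI; apply.
by rewrite (_ : [set y | _] = `]-oo, r%:E]%classic)//; exact: emeasurable_itv.
Qed.

Variables (tau : nat -> R) (v : nat -> U -> R) (Mdelta Meps M0 : R).

(** The equation on [model_data] says that the data under [b th] are the data under 0 at a
    translated sample point. All success events thus become events of the single measure P. The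
    number kappa bounds how many hypotheses lie within squared distance 4 r of a given one. *)
Lemma worst_success_le (Th : finType) (b : Th -> U -> R)
    (g : Th -> 'I_N -> U -> R) (r t C kappa : R) :
  s != 0 -> 0 < t -> 0 <= r -> (0 < #|Th|)%N ->
  (forall th, admissible mu tau v Mdelta Meps M0 (Mod (b th))) ->
  (forall th, continuous (b th)) -> (forall th, inL2 mu (b th)) ->
  (forall th j, measurable_fun setT (g th j : borel U -> R)) ->
  (forall th (w : Om), model_data X (M := Mod (b th)) w
     = model_data X (M := Mod (cst 0)) (@shift _ (borel U) R N (g th) w)) ->
  (forall th, (\prod_(j < N) \int[mu]_(x in [set: borel U])
     (expR (g th j x ^+ 2 / s ^+ 2))%:E <= C%:E)%E) ->
  (forall th0, (#|[pred th | \int[mu]_(x in [set: borel U])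
      ((b th x - b th0 x) ^+ 2)%:E <= (4 * r)%:E]%E|)%:R <= kappa) ->
  (worst_success X tau v Mdelta Meps M0 bhat r
    <= (t * (kappa / #|Th|%:R) + C / (4 * t))%:E)%E.
Proof.
move=> s0 t0 r0 Th0 adm b_cont bL2 mg shiftE gC sep.
have k0 : 0 <= kappa.
  by have /card_gt0P[th _] := Th0; apply: le_trans (sep th).
(* Reading a single component of the estimator enlarges the success event, which is harmless for an
   upper bound. *)
pose S th := [set w : Om | (normL2 mu (fun x =>
  (bhat (model_data X (M := Mod (cst 0)) w) l0 q0 x - b th x)%R)
    <= (Num.sqrt r)%:E)%E].
have mS th : measurable (S th).
  apply: (measurable_model_data _ [set D | (normL2 mu (fun x =>
    (bhat D l0 q0 x - b th x)%R) <= (Num.sqrt r)%:E)%E]).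
    by move=> x; exact: cst_continuous.
  exact: estim_measurable.
set W := worst_success _ _ _ _ _ _ _ _.
have WP th : (W <= (t * fine (P (S th)) + C / (4 * t))%:E)%E.
  have WPS : (W <= P (@shift _ (borel U) R N (g th) @^-1` S th))%E.
    apply: (@le_trans _ _ (P [set w : Om | (excess_risk mu
      (bhat (model_data X (M := Mod (b th)) w)) (beta (Mod (b th))) <= r%:E)%E])).
      by apply: ereal_inf_lbound; exists (Mod (b th)).
    apply: le_measure; rewrite ?inE.
    - exact: measurable_success.
    - by rewrite -[X in measurable X]setTI; apply: measurable_shift.
    move=> w /= /(excess_risk_le_normL2 l0 q0 r0).
    rewrite /S /= -shiftE; apply: le_trans.
    rewrite le_eqVlt; apply/orP; left; apply/eqP; congr normL2.
    by apply/funext => x; rewrite /= eqxx mul1r.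
  apply: le_trans WPS _.
  apply: le_trans (design_noise_shift_le mu (g th) (S th) t s0 (mg th) (mS th) t0) _.
  rewrite EFinD; apply: leeD.
    by rewrite EFinM fineK// fin_num_measure.
  rewrite (mulrC C) EFinM; apply: lee_wpmul2l => //.
  by rewrite lee_fin invr_ge0; lra.
(* The sum is the expected number of events [S th] that hold. If the one of th0 holds, all th whose
   events hold have [b th] close to [b th0], so their number is at most kappa. *)
have sumP : \sum_th fine (P (S th)) <= kappa.
  rewrite -lee_fin -sumEFin.
  rewrite (_ : (\sum_(i in Th) _ = \int[P]_w \sum_(th in Th) (\1_(S th) w)%:E)%E); last first.
    rewrite ge0_integral_sum//.
    - apply: eq_bigr => th _; rewrite integral_indic// setIT fineK// fin_num_measure//.
    - by move=> th; apply/measurable_EFinP.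
  apply: (@le_trans _ _ (\int[P]_w kappa%:E)%E).
    apply: ge0_le_integral => //.
    - by move=> w _; apply: sume_ge0 => th _; rewrite lee_fin.
    - by apply: emeasurable_sum => th; apply/measurable_EFinP.
    move=> w _; rewrite sumEFin lee_fin.
    under eq_bigr do rewrite indicE.
    rewrite -natr_sum.
    rewrite (_ : (\sum_(i in Th) (w \in S i) = #|[pred i | w \in S i]|)%N); last first.
      rewrite -[RHS]sum1_card [RHS]big_mkcond; apply: eq_bigr => i _ /=.
      by rewrite inE; case: (_ \in S i).
    have [[th0 /set_mem Sth0]|none] := pselect (exists th, w \in S th).
      apply: le_trans (sep th0); rewrite ler_nat; apply: subset_leq_card; apply/fintype.subsetP => th.
      rewrite !inE => Sth.
      by apply: (L2_ball_diameter r0 _ _ _ Sth Sth0) => //; exact: estim_L2.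
    rewrite eq_card0// => th; apply/negP; rewrite !inE => wS; apply: none.
    by exists th; rewrite inE.
  rewrite integral_cst// -[leRHS]mule1; apply: lee_wpmul2l; first by rewrite lee_fin.
  exact: probability_le1.
case: W WP => [x WP| WP | WP].
- rewrite lee_fin -(ler_pM2l (_ : 0 < #|Th|%:R)) ?ltr0n//.
  have -> : #|Th|%:R * x = \sum_(th in Th) x by rewrite sumr_const mulr_natl.
  apply: (@le_trans _ _ (\sum_(th in Th) (t * fine (P (S th)) + C / (4 * t)))).
    by apply: ler_sum => th _; have := WP th; rewrite lee_fin.
  rewrite big_split/= -mulr_sumr sumr_const.
  rewrite -[X in _ + X <= _]mulr_natl mulrDr lerD2r.
  rewrite [leRHS](_ : _ = t * kappa); last by field; rewrite pnatr_eq0 -lt0n.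
  by rewrite ler_wpM2l// ltW.
- by have /card_gt0P[th _] := Th0; have := WP th.
- exact: leNye.
Qed.

End many_hypotheses.

Arguments worst_success_le {R U mu p L n m} X q0 l0 m_ge1 s e kap e_cont bhat
  tau v Mdelta Meps M0 {Th} b g {r t C kappa}.

(** * Finite sums of eigenfunctions *)

Section mercer.
Context (R : realType) (U : ptopologicalType) (mu : probability (borel U) R).
Context (K : U -> U -> R) (tau : nat -> R) (v : nat -> U -> R).
Hypothesis K_kernel : continuous_pd_kernel K.
Hypothesis K_mercer : mercer_expansion mu K tau v.
Hypothesis U_compact : compact [set: U].

Lemma mercer_tau_gt0 k : 0 < tau k.
Proof. by case: K_mercer => -[]. Qed.

Lemma mercer_diag_bounded : exists2 B, 0 <= B & forall x, K x x <= B.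
Proof.
have diag_cont : continuous (fun x : U => K x x).
  have [_ _ cK _] := K_kernel.
  move=> x; have := cK (x, x).
  apply: (@continuous_comp _ _ _ (fun x : U => (x, x)) (fun z => K z.1 z.2)).
  by apply: cvg_pair; exact: cvg_id.
have /compact_bounded[M [_ /(_ (M + 1))]] : compact ((fun x : U => K x x) @` setT).
  by apply: continuous_compact => //; exact: continuous_subspaceT.
rewrite ltrDl ltr01 => /(_ isT) KM.
exists `|M + 1| => // x.
apply: le_trans (ler_norm _) _; apply: le_trans (ler_norm (M + 1)).
by apply: KM; exists x.
Qed.

Lemma mercer_partial_sum_le n x :
  \sum_(k < n) tau k * v k x ^+ 2 <= K x x.
Proof.
have [_ _ _ /(_ x x) sK] := K_mercer.
have -> : \sum_(k < n) tau k * v k x ^+ 2 =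
    series (fun k => tau k * v k x * v k x) n.
  by rewrite /series /= big_mkord; apply: eq_bigr => k _; rewrite expr2 mulrA.
rewrite -(cvg_lim _ sK)//; apply: nondecreasing_cvgn_le; last by apply/cvg_ex; exists (K x x).
apply: nondecreasing_series => k _ _.
by rewrite -mulrA -expr2 mulr_ge0 ?sqr_ge0// ltW// mercer_tau_gt0.
Qed.

Definition eigen_sum n (c : nat -> R) (x : U) : R := \sum_(k < n) c k * v k x.

(** The inequality |c v| <= (c^2 / tau + tau v^2) / 2, summed, is a form of the reproducing
    property: the first part is the squared RKHS norm, the second is at most K(x, x). The bound does
    not depend on n. *)
Lemma eigen_sum_bounded n (c : nat -> R) S B x : \sum_(k < n) c k ^+ 2 / tau k <= S ->
  (forall x, K x x <= B) -> `|eigen_sum n c x| <= (S + B) / 2.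
Proof.
move=> cS KB; have := le_trans (mercer_partial_sum_le n x) (KB x) => vB.
apply: le_trans (ler_norm_sum _ _ _) _.
apply: (@le_trans _ _ (\sum_(k < n) (c k ^+ 2 / tau k + tau k * v k x ^+ 2) / 2)).
  apply: ler_sum => k _; have t0 := mercer_tau_gt0 k.
  rewrite normrM -(real_normK (num_real (c k))) -(real_normK (num_real (v k x))).
  rewrite -subr_ge0 (_ : _ - _ =
    (`|c k| - tau k * `|v k x|) ^+ 2 / (2 * tau k)); last by field; rewrite gt_eqF.
  by rewrite divr_ge0 ?sqr_ge0// mulr_ge0// ltW.
by rewrite -mulr_suml big_split/= ler_pM2r// lerD.
Qed.

Lemma eigen_sum_continuous n c : continuous (eigen_sum n c).
Proof.
have [_ _ cv _] := K_mercer.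
move=> x; apply: cvg_big => [|k _]; first exact: add_continuous.
by apply: cvgM; [exact: cvg_cst|exact: cv].
Qed.

Lemma eigen_sum_measurable n c :
  measurable_fun [set: borel U] (eigen_sum n c : borel U -> R).
Proof. by apply: continuous_borel_measurable; exact: eigen_sum_continuous. Qed.

Lemma eigen_sum_inL2 n c : inL2 mu (eigen_sum n c).
Proof.
have [B _ KB] := mercer_diag_bounded.
apply: (@bounded_inL2 _ _ _ _ ((\sum_(k < n) c k ^+ 2 / tau k + B) / 2)).
  exact: eigen_sum_measurable.
by move=> x; exact: eigen_sum_bounded.
Qed.

Lemma mercer_vv_integrable (f : U -> R) j : inL2 mu f ->
  mu.-integrable [set: borel U] (fun x => (f x * v j x)%:E).
Proof.
have [_ [vL2 _] _ _] := K_mercer.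
by move=> fL2; apply/Lfun1_integrable; exact: (Lfun2_mul_Lfun1 fL2 (vL2 j)).
Qed.

Lemma mercer_integral_inner (f : U -> R) j : inL2 mu f ->
  (\int[mu]_(x in [set: borel U]) (f x * v j x)%:E = (innerL2 mu f (v j))%:E)%E.
Proof.
move=> fL2; rewrite /innerL2 /Rintegral fineK//.
by apply: integrable_fin_num => //; exact: mercer_vv_integrable.
Qed.

Lemma eigen_sum_integral n c j :
  (\int[mu]_(x in [set: borel U]) (eigen_sum n c x * v j x)%:E
   = ((j < n)%:R * c j)%:E)%E.
Proof.
have [_ [vL2 vO] _ _] := K_mercer.
under eq_integral => x _.
  rewrite /eigen_sum mulr_suml -sumEFin.
  under eq_bigr do rewrite -mulrA EFinM.
  over.
rewrite integral_sum//; last first.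
  by move=> k; apply: integrableZl => //; exact: mercer_vv_integrable.
under eq_bigr => k _.
  rewrite integralZl//; last exact: mercer_vv_integrable.
  rewrite mercer_integral_inner// vO -EFinM.
  over.
rewrite sumEFin; congr EFin; have [jn|nj] := ltnP j n.
  rewrite (bigD1 (Ordinal jn))//= eqxx mulr1 big1 ?addr0 ?mul1r// => k kj.
  by rewrite (_ : _ == _ = false) ?mulr0//; apply: contraNF kj => /eqP kj; apply/eqP/val_inj.
rewrite mul0r big1// => k _; rewrite (_ : _ == _ = false) ?mulr0//.
by apply/negbTE; rewrite neq_ltn (leq_trans (ltn_ord k) nj).
Qed.

Lemma eigen_sum_sqr n (c : nat -> R) :
  (\int[mu]_(x in [set: borel U]) (eigen_sum n c x ^+ 2)%:E
   = (\sum_(k < n) c k ^+ 2)%:E)%E.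
Proof.
under eq_integral => x _.
  rewrite expr2 {2}/eigen_sum mulr_sumr -sumEFin.
  under eq_bigr do rewrite mulrCA EFinM.
  over.
rewrite integral_sum//; last first.
  by move=> k; apply: integrableZl => //; apply: mercer_vv_integrable; exact: eigen_sum_inL2.
rewrite -sumEFin; apply: eq_bigr => k _.
rewrite integralZl//; last by apply: mercer_vv_integrable; exact: eigen_sum_inL2.
by rewrite eigen_sum_integral ltn_ord mul1r -EFinM.
Qed.

Lemma eigen_sum_terms n c k :
  rkhs_terms mu tau v (eigen_sum n c) k = (k < n)%:R * (c k ^+ 2 / tau k).
Proof.
rewrite /rkhs_terms; have := eigen_sum_integral n c k.
rewrite mercer_integral_inner; last exact: eigen_sum_inL2.
by move=> [->]; case: (k < n)%N; rewrite ?mul1r// !mul0r expr0n/= mul0r.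
Qed.

Lemma eigen_sum_series_cvg n (c : nat -> R) :
  series (rkhs_terms mu tau v (eigen_sum n c)) @ \oo -->
  \sum_(k < n) c k ^+ 2 / tau k.
Proof.
apply: cvg_near_cst; exists n => // N /= nN.
rewrite /series/= (big_cat_nat (leq0n n) nN)/=.
rewrite [X in _ + X]big_nat_cond [X in _ + X]big1 ?addr0 => [|k /andP[/andP[nk _] _]].
  by rewrite big_mkord; apply: eq_bigr => k _; rewrite eigen_sum_terms ltn_ord mul1r.
by rewrite eigen_sum_terms ltnNge nk mul0r.
Qed.

Lemma eigen_sum_in_rkhs n c : in_rkhs mu tau v (eigen_sum n c).
Proof.
split.
- exact: eigen_sum_continuous.
- split; first exact: eigen_sum_inL2.
  move=> e e0; exists n, c.
  rewrite (_ : (fun x => _) = cst 0); last by apply/funext => x; rewrite subrr.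
  rewrite [ltLHS](_ : _ = 0%E) ?lte_fin//.
  by apply: (@Lnorm0 _ (borel U) R mu 2%:E); rewrite eqe pnatr_eq0.
- by apply/cvg_ex; eexists; exact: eigen_sum_series_cvg.
Qed.

Lemma eigen_sum_rkhs_norm n (c : nat -> R) M : 0 <= M ->
  \sum_(k < n) c k ^+ 2 / tau k <= M ^+ 2 ->
  rkhs_norm mu tau v (eigen_sum n c) <= M.
Proof.
move=> M0 cM; rewrite /rkhs_norm (cvg_lim _ (eigen_sum_series_cvg n c))//.
by rewrite -(ger0_norm M0) -sqrtr_sqr ler_wsqrtr.
Qed.

Lemma eigen_sum0 c : eigen_sum 0 c = cst 0.
Proof. by apply/funext => x; rewrite /eigen_sum big_ord0. Qed.

Lemma eigen_sumB n c c' x :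
  eigen_sum n c x - eigen_sum n c' x = eigen_sum n (fun k => c k - c' k) x.
Proof. by rewrite /eigen_sum -sumrB; apply: eq_bigr => k _; rewrite mulrBl. Qed.

End mercer.

Arguments eigen_sum {R U} v n c x.
Arguments mercer_tau_gt0 {R U mu K tau v}.
Arguments mercer_diag_bounded {R U K}.
Arguments eigen_sum_bounded {R U mu K tau v} _ n c {S B} x.
Arguments eigen_sum_continuous {R U mu K tau v}.
Arguments eigen_sum_measurable {R U mu K tau v}.
Arguments eigen_sum_inL2 {R U mu K tau v}.
Arguments eigen_sum_sqr {R U mu K tau v}.
Arguments eigen_sum_in_rkhs {R U mu K tau v}.
Arguments eigen_sum_rkhs_norm {R U mu K tau v} _ _ _ n c {M}.
Arguments eigen_sum0 {R U}.
Arguments eigen_sumB {R U}.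

(** * Lower bounds for a fixed sample size *)

Section cube.
Context (R : realType) (D : nat).
Implicit Types f : {ffun 'I_D -> bool}.

(* The coefficients with indices in [D, 2D) encode a vertex of the cube. *)
Definition cube_coef (a : R) f (k : nat) : R :=
  if (k < D)%N then 0 else a * (oapp f false (insub (k - D)%N))%:R.

Lemma cube_coef_low a f (i : 'I_D) : cube_coef a f i = 0.
Proof. by rewrite /cube_coef ltn_ord. Qed.

Lemma cube_coef_high a f (i : 'I_D) : cube_coef a f (D + i)%N = a * (f i)%:R.
Proof. by rewrite /cube_coef ltnNge leq_addr /= addKn valK. Qed.

Lemma sum_high_coef (F : nat -> R) : (forall i : 'I_D, F i = 0) ->
  \sum_(k < D + D) F k = \sum_(i < D) F (D + i)%N.
Proof. by move=> F0; rewrite big_split_ord/= big1 ?add0r. Qed.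

Definition hamming f f0 := (\sum_(i < D) (f i != f0 i))%N.

Lemma cube_coef_dist a f f0 :
  \sum_(k < D + D) (cube_coef a f k - cube_coef a f0 k) ^+ 2
  = a ^+ 2 * (hamming f f0)%:R.
Proof.
rewrite (sum_high_coef (fun k => (cube_coef a f k - cube_coef a f0 k) ^+ 2)).
  rewrite natr_sum mulr_sumr; apply: eq_bigr => i _.
  rewrite !cube_coef_high -mulrBr exprMn; congr (_ * _).
  by case: (f i) (f0 i) => [] []; rewrite /= ?subrr ?subr0 ?sub0r ?expr0n ?sqrrN ?expr1n.
by move=> i; rewrite !cube_coef_low subrr expr0n.
Qed.

(* Chernoff's bound: [4 H <= D] implies [1 <= (3/4) ^ (4 H - D)], and
   (1 + (3/4)^4) / (3/4) = 337/192. *)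
Lemma cube_ball_card f0 :
  #|[pred f | (4 * hamming f f0 <= D)%N]|%:R <= (337 / 192) ^+ D :> R.
Proof.
pose y : R := 3 / 4.
have y0 : 0 < y by rewrite /y; lra.
have y1 : y <= 1 by rewrite /y; lra.
have -> : (337 / 192) ^+ D = \sum_f (y ^+ 4) ^+ hamming f f0 / y ^+ D.
  have hamE f : (y ^+ 4) ^+ hamming f f0 = \prod_(i < D) (y ^+ 4) ^+ (f i != f0 i).
    by rewrite /hamming (big_morph _ (exprD (y ^+ 4)) (expr0 _)).
  rewrite -mulr_suml; under eq_bigr do rewrite hamE.
  (* The sum over the cube factorises into D sums over one bit, each equal to 1 + y^4. *)
  rewrite -(bigA_distr_bigA (fun i b => (y ^+ 4) ^+ (b != f0 i))).
  rewrite (eq_bigr (fun=> 1 + y ^+ 4)) ?prodr_const ?card_ord -?expr_div_n.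
    by congr (_ ^+ D); rewrite /y; field.
  by move=> i _; rewrite big_bool; case: (f0 i); rewrite /= ?expr0 ?expr1// addrC.
rewrite -sum1_card natr_sum big_mkcond; apply: ler_sum => f _ /=.
case: ifP => [|_]; last by rewrite divr_ge0 ?exprn_ge0 ?ltW// exprn_ge0// ltW.
rewrite inE => HD; rewrite ler_pdivlMr ?exprn_gt0// mul1r -exprM.
by rewrite ler_wiXn2l// ltW.
Qed.

End cube.

Arguments cube_coef {R D} a f k.
Arguments sum_high_coef {R} D F.
Arguments cube_ball_card {R D} f0.

Section lower_bounds.
Context (R : realType) (U : ptopologicalType) (mu : probability (borel U) R).
Context (K : U -> U -> R) (tau : nat -> R) (v : nat -> U -> R).
Hypothesis K_kernel : continuous_pd_kernel K.
Hypothesis K_mercer : mercer_expansion mu K tau v.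
Hypothesis U_compact : compact [set: U].
Context (p L n : nat) (m : 'I_n -> nat) (X : 'M[R]_(n, p)).
Variables (q0 : 'I_p) (l0 : 'I_L) (m_ge1 : forall i, (1 <= m i)%N).
Variables (zeta Mdelta Meps M0 s : R).
Hypothesis X_le : forall i q, `|X i q| <= zeta.
Hypothesis M0_gt0 : 0 < M0.
Hypothesis s_neq0 : s != 0.
Hypothesis s_delta : 8 * expR (2^-1) * s ^+ 2 <= Mdelta.
Variable bhat : estimator p L m mu.
Local Notation N := #|obs m|.
Local Notation Om := (N.-tuple (borel U) * N.-tuple R)%type.
Local Notation W := (worst_success X tau v Mdelta Meps M0 bhat).

Lemma sqr_X_le i q : X i q ^+ 2 <= zeta ^+ 2.
Proof.
rewrite -(real_normK (num_real (X i q))) lerXn2r ?nnegrE//.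
exact: le_trans (X_le i q).
Qed.

Lemma sum_delta_q0 i (y : R) :
  \sum_(q < p) X i q * ((q == q0)%:R * y) = X i q0 * y.
Proof.
rewrite (bigD1 q0)//= eqxx mul1r big1 ?addr0// => q /negbTE ->.
by rewrite mul0r mulr0.
Qed.

Lemma zero_in_rkhs : in_rkhs mu tau v (cst 0) /\ rkhs_norm mu tau v (cst 0) <= M0.
Proof.
rewrite -(eigen_sum0 v (fun=> 0)); split.
  exact: (eigen_sum_in_rkhs K_kernel K_mercer U_compact).
apply: (eigen_sum_rkhs_norm K_kernel K_mercer U_compact) => //; first exact: ltW.
by rewrite big_ord0 sqr_ge0.
Qed.

(** Only one coordinate per curve is translated, by at most zeta |a| / sqrt n. The n squares add up
    to a bound free of n, and the numbers m_i do not enter. *)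
Lemma parametric_lower_bound (a Be r : R) (G : nat) :
  (0 < n)%N -> (0 < G)%N -> 0 <= r -> (forall x, `|v 0 x| <= Be) ->
  8 * expR (2^-1) * s ^+ 2 * Be ^+ 2 <= Meps ->
  a ^+ 2 / tau 0 <= M0 ^+ 2 -> 4 * r < a ^+ 2 / (G%:R ^+ 2 * n%:R) ->
  (W r <= (Num.sqrt G%:R / G%:R
           + expR (zeta ^+ 2 * a ^+ 2 / s ^+ 2) / (4 * Num.sqrt G%:R))%:E)%E.
Proof.
move=> n0 G0 r0 vB s_eps aM rG.
have Gr0 : 0 < G%:R :> R by rewrite ltr0n.
have nr0 : 0 < n%:R :> R by rewrite ltr0n.
have [_ _ v_cont _] := K_mercer.
have tau0 : 0 < tau 0 by exact: (mercer_tau_gt0 K_mercer 0).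
pose th (k : 'I_G) : R := k%:R / G%:R * (a / Num.sqrt n%:R).
have th2 (k : 'I_G) : th k ^+ 2 <= a ^+ 2 / n%:R.
  rewrite /th !exprMn exprVn exprVn sqr_sqrtr ?ler0n//.
  rewrite ler_piMl ?divr_ge0 ?sqr_ge0//.
  rewrite ler_pdivrMr ?exprn_gt0// mul1r lerXn2r ?nnegrE ?ler0n//.
  by rewrite ler_nat ltnW.
pose b (k : 'I_G) := eigen_sum v 1 (fun=> th k).
(* Since eps_i is built on the first observation of its curve, that noise coordinate alone has to
   move. *)
pose gam (k : 'I_G) (ij : obs m) : R :=
  if ij == first_obs m_ge1 (tag ij) then X (tag ij) q0 * th k else 0.
have -> : Num.sqrt G%:R / G%:R = Num.sqrt G%:R * (1 / #|'I_G|%:R) :> R.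
  by rewrite card_ord mul1r.
apply: (worst_success_le X q0 l0 m_ge1 s (v 0) false (v_cont 0) bhat
  tau v Mdelta Meps M0 b (fun k j => cst (gam k (enum_val j)))) => //.
- by rewrite sqrtr_gt0.
- by rewrite card_ord.
- move=> k; apply: (noise_model_admissible Be) => //.
  + exact: (eigen_sum_in_rkhs K_kernel K_mercer U_compact).
  + apply: (eigen_sum_rkhs_norm K_kernel K_mercer U_compact) => //; first exact: ltW.
    rewrite big_ord_recl big_ord0 addr0; apply: le_trans aM.
    rewrite ler_pM2r ?invr_gt0//; apply: le_trans (th2 k) _.
    by rewrite ler_pdivrMr// ler_peMr ?sqr_ge0// ler1n.
  + by case: zero_in_rkhs.
  + by case: zero_in_rkhs.
- by move=> k; exact: (eigen_sum_continuous K_mercer).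
- by move=> k; exact: (eigen_sum_inL2 K_kernel K_mercer U_compact).
(* As [b k] is a multiple of v_0, X b(u) + z v_0(u) = (z + X th) v_0(u): the translation of z does
   not depend on the location. *)
- move=> k w; congr Data; apply/funext => ij; apply/funext => l.
  rewrite /response /= !sum_delta_q0 /scaled_noise !mul0r !addr0 mulr0 add0r.
  rewrite /noise /shift /= tnth_mktuple /= enum_rankK /gam /= eqxx.
  rewrite /b /eigen_sum big_ord_recl big_ord0 addr0 /= /location /=.
  by rewrite mulrDl addrC mulrA.
- move=> k.
  rewrite (_ : (\prod_(j < N) _)%E =
     (\prod_(j < N) expR (gam k (enum_val j) ^+ 2 / s ^+ 2))%:E); last first.
    rewrite -prodEFin; apply: eq_bigr => j _.
    rewrite (integral_cst mu measurableT (expR (gam k (enum_val j) ^+ 2 / s ^+ 2))%:E).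
    by rewrite [X in (_ * X)%E](@probability_setT _ _ _ mu) mule1.
  rewrite lee_fin -expR_sum ler_expR -mulr_suml ler_pM2r ?invr_gt0 ?exprn_even_gt0//.
  rewrite -(big_enum_val (fun ij : obs m => gam k ij ^+ 2))/=.
  rewrite (bigID (fun ij : obs m => ij == first_obs m_ge1 (tag ij)))/=.
  rewrite [X in _ + X]big1 ?addr0; last first.
    by move=> ij /negbTE ijF; rewrite /gam ijF expr0n.
  rewrite (reindex_onto (first_obs m_ge1) (fun ij => tag ij)); last first.
    by move=> ij /eqP <-.
  apply: (@le_trans _ _ (\sum_(i < n) zeta ^+ 2 * (a ^+ 2 / n%:R))).
    rewrite big_mkcond /=; apply: ler_sum => i _; case: ifP => _; last first.
      by rewrite mulr_ge0 ?sqr_ge0// divr_ge0 ?sqr_ge0.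
    rewrite /gam /= eqxx exprMn ler_pM ?sqr_ge0//; exact: sqr_X_le.
  rewrite sumr_const card_ord -mulr_natr le_eqVlt; apply/orP; left; apply/eqP.
  by field; rewrite gt_eqF.
(* Two distinct hypotheses are at squared distance at least a^2 / (G^2 n) > 4 r, so no other one is
   close to [k0]. *)
- move=> k0; rewrite -[leRHS]/(1%N%:R) ler_nat -[leqRHS](card1 k0).
  apply: subset_leq_card; apply/fintype.subsetP => k; rewrite !inE.
  apply: contraLR => kk0; rewrite -ltNge.
  rewrite (_ : (fun x => _) = (fun x => (eigen_sum v 1 (fun=> th k - th k0) x ^+ 2)%:E)); last first.
    by apply/funext => x; rewrite eigen_sumB.
  rewrite (eigen_sum_sqr K_kernel K_mercer U_compact) lte_fin.
  rewrite big_ord_recl big_ord0 addr0; apply: lt_le_trans rG _.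
  rewrite (_ : th k - th k0 = (k%:R - k0%:R) / G%:R * (a / Num.sqrt n%:R)); last first.
    by rewrite /th -mulrBl -mulrBl.
  rewrite !exprMn !exprVn sqr_sqrtr ?ler0n//.
  rewrite (_ : _ / (_ * _) = 1 * G%:R ^- 2 * (a ^+ 2 / n%:R)); last first.
    by field; rewrite !gt_eqF.
  rewrite ler_wpM2r ?divr_ge0 ?sqr_ge0// ler_wpM2r ?invr_ge0 ?sqr_ge0//.
  rewrite -real_normK ?num_real// expr_ge1//.
  have : (k : nat) != k0 by [].
  rewrite neq_ltn => /orP[] lt; [rewrite distrC|]; rewrite ger0_norm ?subr_ge0 ?ler_nat ?(ltnW lt)//;
    by rewrite lerBrDl natr1 ler_nat.
Qed.

(** The three conditions on a keep the vertices in the RKHS ball, make vertices within squared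
    distance 4 r differ in at most D / 4 bits, and bound the second moment of the likelihood ratio
    by exp(D / 40). *)
Lemma nonparametric_lower_bound (a r B : R) (D : nat) :
  a != 0 -> 0 <= r -> 0 <= Meps -> (forall x, K x x <= B) ->
  (forall k, (D <= k)%N -> (k < D + D)%N -> a ^+ 2 * D%:R / tau k <= M0 ^+ 2) ->
  16 * r <= a ^+ 2 * D%:R ->
  N%:R * (zeta ^+ 2 / s ^+ 2 * expR (zeta ^+ 2 * ((M0 ^+ 2 + B) / 2) ^+ 2 / s ^+ 2)
    * (a ^+ 2 * D%:R)) <= D%:R / 40 ->
  (W r <= ((11 / 10) ^+ D * ((337 / 192) ^+ D / 2 ^+ D)
           + expR (D%:R / 40) / (4 * (11 / 10) ^+ D))%:E)%E.
Proof.
move=> a0 r0 Meps0 KB aM aD info.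
have a2 : 0 < a ^+ 2 by rewrite exprn_even_gt0.
have s2 : 0 < s ^+ 2 by rewrite exprn_even_gt0.
pose b (f : {ffun 'I_D -> bool}) := eigen_sum v (D + D) (cube_coef a f).
pose Bb := (M0 ^+ 2 + B) / 2.
set k1 := zeta ^+ 2 / s ^+ 2 * _ in info.
have k10 : 0 <= k1 by rewrite mulr_ge0 ?expR_ge0// divr_ge0 ?sqr_ge0.
have coefM (f : {ffun 'I_D -> bool}) : \sum_(k < D + D) cube_coef a f k ^+ 2 / tau k <= M0 ^+ 2.
  rewrite (sum_high_coef _ (fun k => cube_coef a f k ^+ 2 / tau k)); last first.
    by move=> i; rewrite cube_coef_low expr0n mul0r.
  apply: (@le_trans _ _ (\sum_(i < D) M0 ^+ 2 / D%:R)).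
    apply: ler_sum => i _; rewrite cube_coef_high.
    have D0 : 0 < D%:R :> R by rewrite ltr0n (leq_ltn_trans _ (ltn_ord i)).
    have t0 := mercer_tau_gt0 K_mercer (D + i).
    rewrite ler_pdivlMr// mulrAC; apply: le_trans (aM (D + i)%N _ _).
    - rewrite ler_pM2r ?invr_gt0// ler_pM2r// exprMn ler_piMr ?sqr_ge0//.
      by case: (f i); rewrite ?expr1n ?expr0n.
    - exact: leq_addr.
    - by rewrite ltn_add2l.
  rewrite sumr_const card_ord -[leLHS]mulr_natr.
  have [D0|D0] := eqVneq D 0%N; first by rewrite {2}D0 mulr0 sqr_ge0.
  by rewrite divfK// pnatr_eq0.
have coef2 (f : {ffun 'I_D -> bool}) : \sum_(k < D + D) cube_coef a f k ^+ 2 <= a ^+ 2 * D%:R.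
  rewrite (sum_high_coef _ (fun k => cube_coef a f k ^+ 2)); last first.
    by move=> i; rewrite cube_coef_low expr0n.
  apply: (@le_trans _ _ (\sum_(i < D) a ^+ 2)).
    apply: ler_sum => i _; rewrite cube_coef_high exprMn ler_piMr ?sqr_ge0//.
    by case: (f i); rewrite ?expr1n ?expr0n.
  by rewrite sumr_const card_ord mulr_natr.
pose g f (j : 'I_N) (x : U) := X (tag (enum_val j)) q0 * b f x.
have mb f : measurable_fun [set: borel U] (b f : borel U -> R).
  exact: (eigen_sum_measurable K_mercer).
have cardTh : #|{ffun 'I_D -> bool}|%:R = 2 ^+ D :> R.
  by rewrite card_ffun card_bool card_ord natrX.
rewrite -cardTh.
have zero_cont : continuous (cst 0 : U -> R) by move=> x; exact: cst_continuous.
apply: (worst_success_le X q0 l0 m_ge1 s (cst 0) true zero_cont bhat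
  tau v Mdelta Meps M0 b g) => //.
- by rewrite -(ltr0n R) cardTh exprn_gt0.
- move=> f; apply: (noise_model_admissible 0) => //.
  + by move=> x; rewrite normr0.
  + by rewrite expr0n mulr0.
  + exact: (eigen_sum_in_rkhs K_kernel K_mercer U_compact).
  + by apply: (eigen_sum_rkhs_norm K_kernel K_mercer U_compact); [exact: ltW|exact: coefM].
  + by case: zero_in_rkhs.
  + by case: zero_in_rkhs.
- by move=> f; exact: (eigen_sum_continuous K_mercer).
- by move=> f; exact: (eigen_sum_inL2 K_kernel K_mercer U_compact).
- by move=> f j; apply: measurable_funM.
- move=> f w; congr Data; apply/funext => ij; apply/funext => l.
  rewrite /response /= !sum_delta_q0 /scaled_noise !mul1r !mulr0 !addr0 add0r.
  by rewrite /noise /shift /= tnth_mktuple /= /g enum_rankK addrC.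
- move=> f.
  have bB x : `|b f x| <= Bb by exact: (eigen_sum_bounded K_mercer).
  (* Each factor is at most 1 + k1 a^2 D <= exp(k1 a^2 D): the squared L2 norm of [b f] enters
     linearly, while its sup norm enters only through the constant [k1]. *)
  have gI j : exists2 I, 0 <= I <= expR (k1 * (a ^+ 2 * D%:R)) &
      (\int[mu]_(x in [set: borel U]) (expR (g f j x ^+ 2 / s ^+ 2))%:E = I%:E)%E.
    have mg : measurable_fun [set: borel U] (fun x : borel U => expR (g f j x ^+ 2 / s ^+ 2)).
      apply: measurableT_comp => //; apply: measurable_funM => //.
      by apply: measurable_funX; apply: measurable_funM.
    have I0 : (0 <= \int[mu]_(x in [set: borel U]) (expR (g f j x ^+ 2 / s ^+ 2))%:E)%E.
      by apply: integral_ge0 => x _; rewrite lee_fin expR_ge0.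
    have : (\int[mu]_(x in [set: borel U]) (expR (g f j x ^+ 2 / s ^+ 2))%:E <=
        (1 + k1 * (a ^+ 2 * D%:R))%:E)%E.
      apply: (@le_trans _ _ (\int[mu]_(x in [set: borel U])
          (1%:E + k1%:E * (b f x ^+ 2)%:E))%E).
        apply: ge0_le_integral => //.
        - exact/measurable_EFinP.
        - apply: emeasurable_funD => //; apply: emeasurable_funM => //.
          by apply/measurable_EFinP; exact: measurable_funX.
        move=> x _; rewrite -EFinM -EFinD lee_fin.
        set y := g f j x ^+ 2 / s ^+ 2.
        have y0 : 0 <= y by rewrite divr_ge0 ?sqr_ge0.
        have yb : y <= zeta ^+ 2 / s ^+ 2 * b f x ^+ 2.
          rewrite /y /g exprMn mulrAC ler_wpM2r ?sqr_ge0// ler_pM2r ?invr_gt0//.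
          exact: sqr_X_le.
        have yB : y <= zeta ^+ 2 * Bb ^+ 2 / s ^+ 2.
          apply: le_trans yb _; rewrite [leRHS]mulrAC ler_wpM2l ?divr_ge0 ?sqr_ge0//.
          rewrite -[leLHS]real_normK ?num_real// lerXn2r ?nnegrE//.
          exact: le_trans (bB x).
        (* From exp(-y) >= 1 - y. With exp(y) replaced by its uniform bound, the right-hand side is
           affine in b^2. *)
        have : expR y <= 1 + y * expR y.
          have := expR_ge1Dx (- y); rewrite expRN => h.
          have e0 := expR_gt0 y.
          have := ler_wpM2l (ltW e0) h; rewrite divff ?gt_eqF//; lra.
        move=> /le_trans; apply; rewrite lerD2l /k1 [leRHS]mulrAC.
        by rewrite ler_pM ?expR_ge0// ler_expR.
      rewrite ge0_integralD//; last 2 first.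
      - by move=> x _; rewrite mule_ge0 ?lee_fin ?sqr_ge0.
      - apply: emeasurable_funM => //.
        by apply/measurable_EFinP; exact: measurable_funX.
      rewrite ge0_integralZl//; last 2 first.
      - by apply/measurable_EFinP; exact: measurable_funX.
      - by move=> x _; rewrite lee_fin sqr_ge0.
      rewrite EFinD; apply: leeD.
        rewrite integral_cst// mul1e; exact: probability_le1.
      rewrite (eigen_sum_sqr K_kernel K_mercer U_compact) -EFinM lee_fin.
      by rewrite ler_wpM2l.
    case: (\int[mu]_(x in _) _)%E I0 => [I I0 I1| |]//; exists I => //.
    rewrite -lee_fin I0/=; rewrite lee_fin in I1; apply: le_trans I1 _.
    exact: expR_ge1Dx.
  have [I IP IE] : exists2 I : 'I_N -> R,
      forall j, 0 <= I j <= expR (k1 * (a ^+ 2 * D%:R)) &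
      forall j, (\int[mu]_(x in [set: borel U]) (expR (g f j x ^+ 2 / s ^+ 2))%:E = (I j)%:E)%E.
    have /choice[I IP] : forall j, exists I, 0 <= I <= expR (k1 * (a ^+ 2 * D%:R)) /\
      (\int[mu]_(x in [set: borel U]) (expR (g f j x ^+ 2 / s ^+ 2))%:E = I%:E)%E.
      by move=> j; have [I ? ?] := gI j; exists I.
    by exists I => j; case: (IP j).
  under eq_bigr do rewrite IE.
  rewrite prodEFin lee_fin.
  apply: (@le_trans _ _ (\prod_(j < N) expR (k1 * (a ^+ 2 * D%:R)))).
    by apply: ler_prod => j _; exact: IP.
  by rewrite prodr_const card_ord -expRM_natl ler_expR.
- move=> f0; apply: le_trans (cube_ball_card f0); rewrite ler_nat.
  apply: subset_leq_card; apply/fintype.subsetP => f; rewrite !inE.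
  rewrite (_ : (fun x => _) = (fun x => (eigen_sum v (D + D)
    (fun k => cube_coef a f k - cube_coef a f0 k) x ^+ 2)%:E)); last first.
    by apply/funext => x; rewrite -eigen_sumB.
  rewrite (eigen_sum_sqr K_kernel K_mercer U_compact) lee_fin cube_coef_dist => hr.
  (* With H the Hamming distance, 4 a^2 H <= 16 r <= a^2 D. *)
  rewrite -(ler_nat R) natrM -(ler_pM2l a2).
  by apply: le_trans aD; lra.
Qed.

End lower_bounds.

Arguments parametric_lower_bound {R U mu K tau v} _ _ _ {p L n m X} q0 l0 m_ge1
  {zeta Mdelta Meps M0 s}.
Arguments nonparametric_lower_bound {R U mu K tau v} _ _ _ {p L n m X} q0 l0 m_ge1
  {zeta Mdelta Meps M0 s}.

(* D is the integer part of A M^(1 / (2h + 1)), plus one. *)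
Lemma dimension_choice (R : realType) (h c0 k1 C2 A M : R) :
  1 <= h -> 0 <= c0 -> 0 <= k1 -> 0 <= C2 -> 1 <= A -> 40 * k1 * C2 * c0 <= A ->
  1 <= M ->
  exists D : nat,
    [/\ (0 < D)%N, M `^ (2 * h + 1)^-1 <= D%:R,
        M `^ (- (2 * h / (2 * h + 1))) <= (2 * A) `^ (2 * h) * D%:R `^ (- (2 * h)) &
        C2 * M * (k1 * (c0 * D%:R `^ (- (2 * h)))) <= D%:R / 40].
Proof.
move=> h1 c00 k10 C20 A1 Ak M1.
pose q := 2 * h + 1; have q0 : 0 < q by rewrite /q; lra.
have A0 : 0 < A by lra.
pose T := M `^ q^-1.
have T1 : 1 <= T.
  rewrite -[leLHS](_ : 1 `^ q^-1 = 1); last by rewrite powR1.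
  by apply: ge0_ler_powR; rewrite ?nnegrE ?invr_ge0 ?(ltW q0)//; lra.
have T0 : 0 < T by lra.
have MT : M = T `^ q by rewrite -powRrM mulVf ?gt_eqF// powRr1//; lra.
pose D := (Num.truncn (A * T)).+1; exists D.
have DAT : A * T <= D%:R by apply: ltW; exact: truncnS_gt.
(* Rounding up costs at most a factor 2, because A T >= 1. *)
have D2AT : D%:R <= 2 * A * T.
  rewrite /D -natr1; have : (Num.truncn (A * T))%:R <= A * T by rewrite truncn_le; nra.
  by nra.
split => //; rewrite -/q.
- by apply: le_trans DAT; rewrite -/T; nra.
- have -> : M `^ (- (2 * h / q)) = (T `^ (2 * h))^-1.
    by rewrite -powRN -powRrM; congr powR; field; rewrite gt_eqF.
  rewrite powRN ler_pdivlMr ?powR_gt0//.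
  have Tp : 0 < T `^ (2 * h) by exact: powR_gt0.
  rewrite [leLHS]mulrC ler_pdivrMr// -[leRHS]powRM; [|lra|lra].
  by apply: ge0_ler_powR; rewrite ?nnegrE; nra.
- have DA : T <= D%:R / A by rewrite ler_pdivlMr// mulrC.
  (* As A >= 1 and q >= 1, (D / A)^q <= D^q / A. This single factor 1 / A is what pays for the
     constants in the last bound. *)
  have MD : M <= D%:R `^ q / A.
    apply: (@le_trans _ _ ((D%:R / A) `^ q)).
      rewrite MT; apply: ge0_ler_powR; rewrite ?nnegrE ?(ltW q0) ?(ltW T0)//.
      by rewrite divr_ge0// ltW.
    rewrite powRM ?ler0n ?invr_ge0 ?(ltW A0)// ler_wpM2l ?powR_ge0//.
    rewrite -powR_inv1 ?(ltW A0)// -powRrM powRN mulN1r powRN powRr1 ?(ltW A0)//.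
    rewrite lef_pV2 ?posrE ?powR_gt0// -[leLHS]powRr1 ?(ltW A0)//.
    by apply: ler_powR => //; rewrite /q; lra.
  have DqD : D%:R `^ q * D%:R `^ (- (2 * h)) = D%:R.
    rewrite -powRD; last by apply/implyP => _; rewrite gt_eqF.
    by rewrite (_ : q - 2 * h = 1) ?powRr1 ?ler0n// /q; ring.
  apply: (@le_trans _ _ (C2 * (D%:R `^ q / A) * (k1 * (c0 * D%:R `^ (- (2 * h)))))).
    by rewrite ler_wpM2r ?mulr_ge0// ler_wpM2l.
  rewrite (_ : _ * _ = k1 * C2 * c0 / A * (D%:R `^ q * D%:R `^ (- (2 * h)))); last first.
    by field; rewrite gt_eqF.
  rewrite DqD mulrC ler_pM2l// ler_pdivrMr//; lra.
Qed.

Arguments dimension_choice {R h c0 k1 C2 A M}.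

Lemma geometric_eventually_le (R : realType) (x eta : R) : 0 <= x -> x < 1 -> 0 < eta ->
  exists K : nat, forall D, (K <= D)%N -> x ^+ D <= eta.
Proof.
move=> x0 x1 eta0.
have /cvgrPdist_le/(_ eta eta0)[K _ KP] : x ^+ k @[k --> \oo] --> 0.
  by apply: cvg_expr; rewrite ger0_norm.
exists K => D KD; have := KP D KD.
by rewrite sub0r normrN ger0_norm ?exprn_ge0.
Qed.

(** The base 11/10 of t lies between exp(1/40), at most 40/39, and 384/337, the inverse of (337/192)
    / 2. Both terms therefore decay geometrically, with ratios 3707/3840 and at most 400/429, below
    97/100. *)
Lemma nonparametric_bound_le (R : realType) (D : nat) :
  (11 / 10) ^+ D * ((337 / 192) ^+ D / 2 ^+ D) + expR (D%:R / 40) / (4 * (11 / 10) ^+ D)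
  <= 5 / 4 * (97 / 100) ^+ D :> R.
Proof.
have e40 : expR (40^-1) <= 40 / 39 :> R.
  have := expR_ge1Dx (- 40^-1 : R); rewrite expRN => h.
  have e0 := expR_gt0 (40^-1 : R).
  by have := ler_wpM2l (ltW e0) h; rewrite divff ?gt_eqF//; lra.
have le1 : (11 / 10) ^+ D * ((337 / 192) ^+ D / 2 ^+ D) <= (97 / 100) ^+ D :> R.
  by rewrite -expr_div_n -exprMn; apply: lerXn2r; rewrite ?nnegrE; lra.
have le2 : expR (D%:R / 40) / (11 / 10) ^+ D <= (97 / 100) ^+ D :> R.
  rewrite expRM_natl -expr_div_n; apply: lerXn2r; rewrite ?nnegrE.
  - by rewrite divr_ge0 ?expR_ge0//; lra.
  - by lra.
  - by rewrite ler_pdivrMr; lra.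
rewrite (_ : expR _ / _ = expR (D%:R / 40) / (11 / 10) ^+ D / 4); first by lra.
by rewrite invfM mulrA mulrAC.
Qed.

Lemma card_obs (R : realType) n (m : 'I_n -> nat) : (0 < n)%N ->
  #|obs m|%:R = n%:R * arith_mean R m.
Proof.
move=> n0; rewrite /arith_mean mulrA divff ?pnatr_eq0 -?lt0n// mul1r -natr_sum.
congr (_%:R); rewrite card_tagged sumnE big_map big_enum /=.
by apply: eq_bigr => i _; rewrite card_ord.
Qed.

Lemma harm_mean_ge1 (R : realType) n (m : 'I_n -> nat) : (0 < n)%N ->
  (forall i, (1 <= m i)%N) -> 1 <= harm_mean R m.
Proof.
move=> n0 m1; rewrite /harm_mean.
have nr0 : 0 < n%:R :> R by rewrite ltr0n.
rewrite invf_ge1.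
  rewrite mulrC ler_pdivrMr// mul1r.
  apply: (@le_trans _ _ (\sum_(i < n) (1 : R))); last by rewrite sumr_const card_ord.
  by apply: ler_sum => i _; rewrite invf_le1 ?ler1n ?ltr0n.
rewrite mulr_gt0 ?invr_gt0// (bigD1 (Ordinal n0))//= ltr_pwDl ?invr_gt0 ?ltr0n//.
by apply: sumr_ge0 => i _; rewrite invr_ge0.
Qed.

Arguments harm_mean_ge1 R {n m}.

(** * Rates *)

Section rates.
Context (R : realType) (U : ptopologicalType) (mu : probability (borel U) R).
Context (K : U -> U -> R) (tau : nat -> R) (v : nat -> U -> R).
Hypothesis K_kernel : continuous_pd_kernel K.
Hypothesis K_mercer : mercer_expansion mu K tau v.
Hypothesis U_compact : compact [set: U].
Context (p L : nat) (q0 : 'I_p) (l0 : 'I_L).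
Variables (X : forall n : nat, 'M[R]_(n, p)) (m : forall n : nat, 'I_n -> nat).
Hypothesis m_ge1 : forall n i, (1 <= m n i)%N.
Variables (zeta Mdelta Meps M0 : R).
Hypothesis X_le : forall n i q, `|X n i q| <= zeta.
Hypothesis (Mdelta_gt0 : 0 < Mdelta) (Meps_gt0 : 0 < Meps) (M0_gt0 : 0 < M0).
Variable bhat : forall n : nat, estimator p L (m n) mu.
Local Notation W n := (worst_success (X n) tau v Mdelta Meps M0 (bhat n)).

(** One s meets both variance bounds. The 1 added to Be^2 keeps the quotient meaningful when Be =
    0. *)
Lemma exists_noise_scale (Be : R) : exists s : R,
  [/\ s != 0, 8 * expR (2^-1) * s ^+ 2 <= Mdelta &
      8 * expR (2^-1) * s ^+ 2 * Be ^+ 2 <= Meps].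
Proof.
pose c : R := 8 * expR (2^-1).
have c0 : 0 < c by rewrite mulr_gt0// expR_gt0.
have B0 : 0 < Be ^+ 2 + 1 by have := sqr_ge0 Be; lra.
pose w := Num.min Mdelta (Meps / (Be ^+ 2 + 1)).
have w0 : 0 < w by rewrite /w lt_min Mdelta_gt0 divr_gt0.
exists (Num.sqrt (w / c)).
have s2 : c * Num.sqrt (w / c) ^+ 2 = w.
  by rewrite sqr_sqrtr ?divr_ge0 ?ltW// mulrC divfK// gt_eqF.
rewrite -/c s2; split.
- by rewrite gt_eqF// sqrtr_gt0 divr_gt0.
- by rewrite /w ge_min lexx.
- apply: (@le_trans _ _ (Meps / (Be ^+ 2 + 1) * (Be ^+ 2 + 1))); last first.
    by rewrite divfK// gt_eqF.
  apply: ler_pM; rewrite ?sqr_ge0 ?(ltW w0)//; last lra.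
  by rewrite /w ge_min lexx orbT.
Qed.

(** The factor 2 in the bound on r anticipates that a sum of two rates is at most twice the larger
    one. *)
Lemma parametric_regime (eta : R) : 0 < eta ->
  exists2 eps, 0 < eps & forall n r, (0 < n)%N -> 0 <= r ->
    r <= 2 * eps / n%:R -> (W n r <= eta%:E)%E.
Proof.
move=> eta0.
have [B B0 KB] := mercer_diag_bounded K_kernel U_compact.
have t0 := mercer_tau_gt0 K_mercer 0.
pose Be := ((tau 0)^-1 + B) / 2.
have vB x : `|v 0 x| <= Be.
  have := eigen_sum_bounded K_mercer 1 (fun=> 1) (S := (tau 0)^-1) x _ KB.
  rewrite /eigen_sum !big_ord_recl !big_ord0 !addr0 expr1n !mul1r /=.
  by apply; rewrite lexx.
have [s [s0 s_delta s_eps]] := exists_noise_scale Be.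
pose a := M0 * Num.sqrt (tau 0).
have a2 : a ^+ 2 = M0 ^+ 2 * tau 0 by rewrite exprMn sqr_sqrtr// ltW.
have a20 : 0 < a ^+ 2 by rewrite a2 mulr_gt0// exprn_gt0.
pose C := expR (zeta ^+ 2 * a ^+ 2 / s ^+ 2).
have C0 : 0 < C by exact: expR_gt0.
(* The bound obtained from G hypotheses is (1 + C / 4) / sqrt G, at most eta as soon as sqrt G >=
   z. *)
pose z := (1 + C / 4) / eta.
have z0 : 0 < z by rewrite divr_gt0//; lra.
pose G := (Num.truncn (z ^+ 2)).+1.
have zG : z <= Num.sqrt G%:R.
  rewrite -(ger0_norm (ltW z0)) -sqrtr_sqr ler_wsqrtr//.
  by apply: ltW; exact: truncnS_gt.
(* Then 4 r is at most half of a^2 / (G^2 n), which leaves room for the strict separation. *)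
exists (a ^+ 2 / (16 * G%:R ^+ 2)); first by rewrite divr_gt0// mulr_gt0// exprn_gt0.
move=> n r n0 r0 rn.
have nr0 : 0 < n%:R :> R by rewrite ltr0n.
apply: le_trans (parametric_lower_bound K_kernel K_mercer U_compact q0 l0
  (m_ge1 n) (X_le n) M0_gt0 s0 s_delta (bhat n) a Be r G n0 _ r0 vB s_eps _ _) _ => //.
- by rewrite a2 mulfK// gt_eqF.
- apply: (@le_lt_trans _ _ (a ^+ 2 / (G%:R ^+ 2 * n%:R) / 2)).
    rewrite (_ : _ / 2 = 4 * (2 * (a ^+ 2 / (16 * G%:R ^+ 2)) / n%:R)).
      by rewrite ler_pM2l.
    by field; rewrite !gt_eqF.
  have : 0 < a ^+ 2 / (G%:R ^+ 2 * n%:R) by rewrite divr_gt0// mulr_gt0// exprn_gt0.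
  lra.
- rewrite lee_fin -/C.
  have S0 : 0 < Num.sqrt G%:R :> R by rewrite sqrtr_gt0.
  have SG : G%:R = Num.sqrt G%:R ^+ 2 :> R by rewrite sqr_sqrtr// ltW.
  rewrite {2}SG (_ : _ + _ = (1 + C / 4) / Num.sqrt G%:R); last first.
    by field; rewrite gt_eqF.
  by rewrite ler_pdivrMr// [leRHS]mulrC -ler_pdivrMr.
Qed.

Variable h : R.
Hypothesis h_ge1 : 1 <= h.
Hypothesis tau_decay : eigenvalue_decay tau h.
Hypothesis means_equiv :
  asymp_equiv (fun n => arith_mean R (m n)) (fun n => harm_mean R (m n)).

Lemma nonparametric_regime (eta : R) : 0 < eta ->
  exists2 eps, 0 < eps & \forall n \near \oo, forall r, 0 <= r ->
    r <= 2 * eps * (n%:R * harm_mean R (m n)) `^ (- (2 * h / (2 * h + 1))) ->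
    (W n r <= eta%:E)%E.
Proof.
move=> eta0.
have [B B0 KB] := mercer_diag_bounded K_kernel U_compact.
have [s [s0 s_delta _]] := exists_noise_scale 0.
have [c [c' [c0 [K0 _ tauP]]]] := tau_decay.
have [c2 [C2' [_ meansP]]] := means_equiv.
pose C2 := Num.max 0 C2'.
have C20 : 0 <= C2 by rewrite /C2 le_max lexx.
pose k1 := zeta ^+ 2 / s ^+ 2 * expR (zeta ^+ 2 * ((M0 ^+ 2 + B) / 2) ^+ 2 / s ^+ 2).
have k10 : 0 <= k1 by rewrite mulr_ge0 ?expR_ge0// divr_ge0 ?sqr_ge0.
(* For k < 2D one has k + 1 <= 2D, hence tau k >= c (2D)^(-2h). This c1 is what makes a^2 D = c1
   D^(-2h) fit under M0^2 tau k. *)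
pose c1 := c * M0 ^+ 2 / 2 `^ (2 * h).
have c10 : 0 < c1 by rewrite divr_gt0 ?powR_gt0// mulr_gt0// exprn_gt0.
pose A := Num.max 1 (40 * k1 * C2 * c1).
have A1 : 1 <= A by rewrite /A le_max lexx.
have Ak : 40 * k1 * C2 * c1 <= A by rewrite /A le_max lexx orbT.
have [K1 K1P] : exists K, forall D, (K <= D)%N -> (97 / 100) ^+ D <= 4 / 5 * eta :> R.
  by apply: geometric_eventually_le; lra.
have h0 : 0 < h by exact: lt_le_trans h_ge1.
have h20 : 0 < 2 * h + 1 by rewrite addr_gt0// mulr_gt0.
have A2 : 0 < (2 * A) `^ (2 * h) by rewrite powR_gt0//; lra.
(* Chosen so that 16 r <= c1 D^(-2h) once the rate is bounded by (2A)^(2h) D^(-2h). *)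
exists (c1 / (32 * (2 * A) `^ (2 * h))); first by rewrite divr_gt0// mulr_gt0.
near=> n => r r0 rM.
have n0 : (0 < n)%N by near: n; exact: nbhs_infty_gt.
have nr0 : 0 < n%:R :> R by rewrite ltr0n.
have hm1 := harm_mean_ge1 R n0 (m_ge1 n).
set M := n%:R * harm_mean R (m n) in rM.
have nM : n%:R <= M by rewrite /M ler_peMr// ltW.
have M1 : 1 <= M by apply: le_trans nM; rewrite ler1n.
(* The noise variables number n times the arithmetic mean, whereas M contains the harmonic mean; the
   upper bound in [means_equiv] links the two. *)
have NM : #|obs (m n)|%:R <= C2 * M.
  rewrite card_obs// /M [leRHS]mulrCA ler_pM2l//.
  have : arith_mean R (m n) / harm_mean R (m n) <= C2'.
    by near: n; move: meansP; apply: filterS => k /andP[].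
  rewrite ler_pdivrMr; last lra.
  by move=> /le_trans; apply; rewrite ler_wpM2r ?le_max ?lexx ?orbT//; lra.
have [D [D0 MD rD infoD]] := dimension_choice h_ge1 (ltW c10) k10 C20 A1 Ak M1.
have Dr0 : 0 < D%:R :> R by rewrite ltr0n.
(* D is at least M^(1/(2h+1)) >= n^(1/(2h+1)), so it exceeds any threshold for large n. *)
have KD : (K0 <= D)%N /\ (K1 <= D)%N.
  suff : (maxn K0 K1 <= D)%N by rewrite geq_max => /andP.
  rewrite -(ler_nat R); apply: le_trans MD.
  apply: (@le_trans _ _ (n%:R `^ (2 * h + 1)^-1)); last first.
    by apply: ge0_ler_powR; rewrite ?nnegrE ?invr_ge0 ?ler0n ?(ltW h20)//; lra.
  rewrite [leLHS](_ : _ = ((maxn K0 K1)%:R `^ (2 * h + 1)) `^ (2 * h + 1)^-1); last first.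
    by rewrite -powRrM mulfV ?lt0r_neq0// powRr1 ?ler0n.
  apply: ge0_ler_powR; rewrite ?nnegrE ?invr_ge0 ?powR_ge0 ?ler0n ?(ltW h20)//.
  by near: n; exact: nbhs_infty_ger.
have [K0D K1D] := KD.
pose a := Num.sqrt (c1 * D%:R `^ (- (2 * h + 1))).
have a2 : a ^+ 2 = c1 * D%:R `^ (- (2 * h + 1)).
  by rewrite sqr_sqrtr// mulr_ge0 ?powR_ge0// ltW.
have a2D : a ^+ 2 * D%:R = c1 * D%:R `^ (- (2 * h)).
  rewrite a2 -mulrA -{2}(powRr1 (ltW Dr0)) -powRD; last by apply/implyP => _; rewrite gt_eqF.
  by congr (_ * _ `^ _); ring.
have a0 : a != 0 by rewrite gt_eqF// sqrtr_gt0 mulr_gt0// powR_gt0.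
apply: le_trans (nonparametric_lower_bound K_kernel K_mercer U_compact q0 l0
  (m_ge1 n) (X_le n) M0_gt0 s0 s_delta (bhat n) a r B D a0 r0 (ltW Meps_gt0) KB _ _ _) _.
- move=> k Dk k2D; have t0 := mercer_tau_gt0 K_mercer k.
  (* The decay of tau is known only from K0 on; the cube uses no index below D. *)
  have K0k : (K0 <= k)%N by exact: leq_trans Dk.
  have /andP[ck _] := tauP k K0k.
  rewrite a2D ler_pdivrMr//; rewrite ler_pdivlMr// in ck.
  apply: (@le_trans _ _ (M0 ^+ 2 * (c * k.+1%:R `^ (- (2 * h))))); last first.
    by rewrite ler_wpM2l ?sqr_ge0.
  rewrite (_ : c1 * _ = M0 ^+ 2 * (c * (2 * D%:R) `^ (- (2 * h)))); last first.
    by rewrite powRM ?ler0n// !powRN /c1; field; rewrite !gt_eqF ?powR_gt0.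
  rewrite ler_wpM2l ?sqr_ge0// ler_wpM2l ?(ltW c0)// !powRN.
  rewrite lef_pV2 ?posrE ?powR_gt0 ?mulr_gt0//.
  apply: ge0_ler_powR; rewrite ?nnegrE ?mulr_ge0 ?(ltW h0)//.
  by rewrite -natrM ler_nat mul2n -addnn.
- rewrite a2D; apply: (@le_trans _ _ (16 * (2 * (c1 / (32 * (2 * A) `^ (2 * h))) *
      ((2 * A) `^ (2 * h) * D%:R `^ (- (2 * h)))))).
    rewrite ler_pM2l//; apply: le_trans rM _; rewrite ler_pM2l//.
    by rewrite mulr_gt0// divr_gt0// mulr_gt0.
  by rewrite le_eqVlt; apply/orP; left; apply/eqP; field; rewrite gt_eqF.
- rewrite -/k1 a2D; apply: le_trans infoD; rewrite ler_wpM2r//.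
  by rewrite mulr_ge0// mulr_ge0 ?powR_ge0// ltW.
- rewrite lee_fin; apply: le_trans (nonparametric_bound_le R D) _.
  by have := K1P D K1D; lra.
Unshelve. all: by end_near. Qed.

End rates.

Arguments parametric_regime {R U mu K tau v} _ _ _ {p L} q0 l0 {X m} m_ge1
  {zeta Mdelta Meps M0}.
Arguments nonparametric_regime {R U mu K tau v} _ _ _ {p L} q0 l0 {X m} m_ge1
  {zeta Mdelta Meps M0}.

(** * Limit superior and conclusion *)

Lemma worst_success_ge0 (R : realType) (U : ptopologicalType)
    (mu : probability (borel U) R) (p L n : nat) (m : 'I_n -> nat)
    (X : 'M[R]_(n, p)) (tau : nat -> R) (v : nat -> U -> R)
    (Mdelta Meps M0 : R) (bhat : estimator p L m mu) (r : R) :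
  (0 <= worst_success X tau v Mdelta Meps M0 bhat r)%E.
Proof. by apply: le_ereal_inf_tmp => _ [M [_ ->]]; exact: measure_ge0. Qed.

Lemma limn_esup_ge0 (R : realType) (u : nat -> \bar R) :
  (forall n, 0 <= u n)%E -> (0 <= limn_esup u)%E.
Proof.
move=> u0; apply: le_ereal_inf_tmp => _ [V oV <-].
have [n Vn] := filter_ex oV.
by apply: le_trans (u0 n) _; apply: ereal_sup_ubound; exists n.
Qed.

Lemma limn_esup_le (R : realType) (u : nat -> \bar R) (y : \bar R) :
  (\forall n \near \oo, u n <= y)%E -> (limn_esup u <= y)%E.
Proof.
move=> uy; apply: (@le_trans _ _ (ereal_sup (u @` [set n | u n <= y]%E))).
  by apply: ereal_inf_lbound; exists [set n | u n <= y]%E.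
by apply: ge_ereal_sup => _ [n un <-].
Qed.

Theorem theorem4p1
  (R : realType)
  (d : nat) (U : ptopologicalType)
  (U_manifold : topological_manifold R d U) (U_compact : compact [set: U])
  (mu : probability (borel U) R) (mu_support : full_support mu)
  (p L : nat) (p_gt0 : (0 < p)%N) (L_gt0 : (0 < L)%N)
  (nu zeta Mdelta Meps M0 : R)
  (nu_ge1 : 1 <= nu) (zeta_gt0 : 0 < zeta) (Mdelta_gt0 : 0 < Mdelta)
  (Meps_gt0 : 0 < Meps) (M0_gt0 : 0 < M0)
  (K : U -> U -> R) (K_kernel : continuous_pd_kernel K)
  (tau : nat -> R) (v : nat -> U -> R)
  (K_mercer : mercer_expansion mu K tau v)
  (h : R) (h_ge1 : 1 <= h) (tau_decay : eigenvalue_decay tau h)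
  (X : forall n : nat, 'M[R]_(n, p)) (X_ok : covariates_ok X nu zeta)
  (m : forall n : nat, 'I_n -> nat) (m_ge1 : forall n i, (1 <= m n i)%N)
  (means_equiv : asymp_equiv (fun n => arith_mean R (m n))
                             (fun n => harm_mean R (m n)))
  (bhat : forall n : nat, estimator p L (m n) mu) :
  (fun e : R => limn_esup (fun n : nat =>
     worst_success (X n) tau v Mdelta Meps M0 (bhat n)
       (e * ((n%:R * harm_mean R (m n)) `^ (- (2 * h / (2 * h + 1)))
             + n%:R^-1))))
  e @[e --> 0^'+] --> 0%E.
Proof.
have X_le := X_ok.2.
set r1 := fun n => (n%:R * harm_mean R (m n)) `^ (- (2 * h / (2 * h + 1))).
have key eta : 0 < eta -> exists2 eps : R, 0 < eps & forall e, 0 < e -> e < eps ->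
    (0 <= limn_esup (fun n => worst_success (X n) tau v Mdelta Meps M0 (bhat n)
       (e * (r1 n + n%:R^-1))) <= eta%:E)%E.
  move=> eta0.
  have [e1 e1_gt0 H1] := parametric_regime K_kernel K_mercer U_compact
    (Ordinal p_gt0) (Ordinal L_gt0) m_ge1 X_le
    Mdelta_gt0 Meps_gt0 M0_gt0 bhat eta eta0.
  have [e2 e2_gt0 H2] := nonparametric_regime K_kernel K_mercer U_compact
    (Ordinal p_gt0) (Ordinal L_gt0) m_ge1 X_le
    Mdelta_gt0 Meps_gt0 M0_gt0 bhat h h_ge1 tau_decay means_equiv eta eta0.
  exists (Num.min e1 e2); first by rewrite lt_min e1_gt0.
  move=> e e0; rewrite lt_min => /andP[ee1 ee2]; apply/andP; split.
    by apply: limn_esup_ge0 => n; exact: worst_success_ge0.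
  apply: limn_esup_le; near=> n.
  have n0 : (0 < n)%N by near: n; exact: nbhs_infty_gt.
  have r10 : 0 <= r1 n by exact: powR_ge0.
  have r0 : 0 <= e * (r1 n + n%:R^-1) by rewrite mulr_ge0 ?addr_ge0// ltW.
  (* Which rate dominates may change with n, so the choice is made for each n separately. *)
  have [le1|/ltW le2] := leP (r1 n) n%:R^-1.
  - apply: H1 => //; nra.
  - have H2n : forall r, 0 <= r -> r <= 2 * e2 * r1 n ->
      (worst_success (X n) tau v Mdelta Meps M0 (bhat n) r <= eta%:E)%E by near: n.
    apply: H2n => //; nra.
apply/fine_cvgP; split.
  (* The limit superior is an extended real; its finiteness near 0 is checked first, with the
     arbitrary bound 1. *)
  have [eps eps0 epsP] := key 1 ltr01.
  near=> e; have /andP[l0 l1] : (0 <= limn_esup (fun n =>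
      worst_success (X n) tau v Mdelta Meps M0 (bhat n)
       (e * (r1 n + n%:R^-1))) <= 1%:E)%E.
    by apply: epsP; [near: e; exact: nbhs_right_gt|near: e; exact: nbhs_right_lt].
  by rewrite ge0_fin_numE//; apply: le_lt_trans l1 (ltry _).
apply/cvgrPdist_le => eta eta0; have [eps eps0 epsP] := key eta eta0.
near=> e; rewrite /= sub0r normrN.
have /andP[l0 l1] : (0 <= limn_esup (fun n =>
    worst_success (X n) tau v Mdelta Meps M0 (bhat n)
     (e * (r1 n + n%:R^-1))) <= eta%:E)%E.
  by apply: epsP; [near: e; exact: nbhs_right_gt|near: e; exact: nbhs_right_lt].
rewrite ger0_norm ?fine_ge0//.
by rewrite -lee_fin fineK// ge0_fin_numE//; apply: le_lt_trans l1 (ltry _).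
Unshelve. all: by end_near. Qed.
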